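(* Suppose there exist constants $\delta>0$ and $0<\varepsilon<1$ such that $D(\delta|i,a,b)\le 1-\varepsilon$ for all $(i,a,b)\in S\times A\times B$. Then for each $i\in S$ and all $z\in\mathbb R^{|K|}$, $$\underline U(z,i)=\max_{p\in\mathcal P(K)}\Big\{\underline V(p,i)-\tfrac1\alpha\langle p,z\rangle\Big\},\qquad \overline U(z,i)=\max_{p\in\mathcal P(K)}\Big\{\overline V(p,i)-\tfrac1\alpha\langle p,z\rangle\Big\},$$ and, dually, for each $i\in S$ and all $p\in\mathcal P(K)$, $$\underline V(p,i)=\min_{z\in\mathbb B}\Big\{\underline U(z,i)+\tfrac1\alpha\langle p,z\rangle\Big\},\qquad \overline V(p,i)=\min_{z\in\mathbb B}\Big\{\overline U(z,i)+\tfrac1\alpha\langle p,z\rangle\Big\},$$ where $\mathbb B:=\{z\in\mathbb R^{|K|}: 0\le z(k)\le c^*\ \forall k\in K\}$.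
   Context: Model. $K,S,A,B$ are finite nonempty sets (game types, states, actions of Player 1, actions of Player 2). For a finite set $E$, $\mathcal P(E)$ is the set of probability distributions on $E$. $Q(\cdot,\cdot|i,a,b)$ is a semi-Markov kernel on $[0,\infty)\times S$ given $S\times A\times B$: for all $i,j,a,b$, $t\mapsto Q(t,j|i,a,b)$ is nondecreasing, right continuous, nonnegative, with $Q(0,j|i,a,b)=0$; $\sum_{j}Q(t,j|i,a,b)\le 1$ for all $t$; and $\sum_j\lim_{t\to\infty}Q(t,j|i,a,b)=1$. Put $D(t|i,a,b):=\sum_{j\in S}Q(t,j|i,a,b)$. The payoff rate is $c:K\times S\times A\times B\to[0,\infty)$, $c^*:=\max c$, and $\alpha>0$ is a fixed discount factor. Policies. $\mathcal H_n=(S\times A\times B)^n\times S$ is the set of histories $h_n=(i_0,a_0,b_0,\dots,a_{n-1},b_{n-1},i_n)$. $\Pi$ is the set of policies of Player 1, i.e. families $\pi=\{\pi_n^{(k)}:k\in K,n\ge0\}$ of stochastic kernels $\pi_n^{(k)}(\cdot|h_n)\in\mathcal P(A)$, $h_n\in\mathcal H_n$. $\Sigma$ is the set of policies of Player 2, i.e. families $\sigma=\{\sigma_n:n\ge0\}$ of stochastic kernels $\sigma_n(\cdot|h_n)\in\mathcal P(B)$. Probability. On $\Omega=K\times(S\times A\times B\times[0,\infty))^\infty$ with product $\sigma$-algebra, for $\omega=(k,i_0,a_0,b_0,t_1,i_1,a_1,b_1,t_2,\dots)$ put $\kappa=k$, $X_n=i_n$, $A_n=a_n$, $B_n=b_n$,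 $T_0=0$, $T_{n}=\sum_{m=1}^{n}t_m$, $H_n=(X_0,A_0,B_0,\dots,A_{n-1},B_{n-1},X_n)$, $T_\infty=\lim_nT_n$. For $p\in\mathcal P(K)$, $i\in S$, $\pi\in\Pi$, $\sigma\in\Sigma$, $\mathbb P_{p,i}^{\pi,\sigma}$ (expectation $\mathbb E_{p,i}^{\pi,\sigma}$) is the unique probability measure with $\mathbb P(X_0=i,\kappa=k)=p_k$; $\mathbb P(A_n=a,B_n=b|\kappa,H_n,T_n)=\pi_n^{(\kappa)}(a|H_n)\sigma_n(b|H_n)$; $\mathbb P(T_{n+1}-T_n\le t,X_{n+1}=j|\kappa,H_n,T_n,A_n,B_n)=Q(t,j|X_n,A_n,B_n)$. Original game. For $t\in[T_n,T_{n+1})$ the continuous-time processes (written with subscript $t$) take the values $X_n,A_n,B_n$. $V(p,i,\pi,\sigma)=\mathbb E_{p,i}^{\pi,\sigma}\big[\int_0^{T_\infty}e^{-\alpha t}c(\kappa,X_t,A_t,B_t)\,dt\big]$; $\underline V(p,i)=\sup_{\pi\in\Pi}\inf_{\sigma\in\Sigma}V(p,i,\pi,\sigma)$, $\overline V(p,i)=\inf_{\sigma\in\Sigma}\sup_{\pi\in\Pi}V(p,i,\pi,\sigma)$. Dual game $G^\#(z)$, $z=\{z(k)\}_{k\in K}\in\mathbb R^{|K|}$. Player 1 himself selects the type: his policies are pairs $\hat\pi=(\rho,\pi)\in\hat\Pi:=\mathcal P(K|S)\times\Pi$, where $\rho=\{\rho_i\in\mathcal P(K):i\in S\}$; Player 2's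 policies are $\Sigma$. Put $\mathbb P_i^{\hat\pi,\sigma}:=\mathbb P_{\rho_i,i}^{\pi,\sigma}$ with expectation $\mathbb E_i^{\hat\pi,\sigma}$, and $U(z,i,\hat\pi,\sigma)=\mathbb E_i^{\hat\pi,\sigma}\big[\int_0^{T_\infty}e^{-\alpha t}(c(\kappa,X_t,A_t,B_t)-z(\kappa))\,dt\big]$. $\underline U(z,i)=\sup_{\hat\pi\in\hat\Pi}\inf_{\sigma\in\Sigma}U(z,i,\hat\pi,\sigma)$, $\overline U(z,i)=\inf_{\sigma\in\Sigma}\sup_{\hat\pi\in\hat\Pi}U(z,i,\hat\pi,\sigma)$. $\langle p,z\rangle=\sum_{k\in K}p_kz(k)$. *)

(* Defs.v *)
From HB Require Import structures.
From mathcomp Require Export all_boot all_order all_algebra.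
From mathcomp Require Export all_classical all_reals all_analysis.

Set Implicit Arguments.
Unset Strict Implicit.
Unset Printing Implicit Defensive.

Export Order.TTheory GRing.Theory Num.Theory.
Export numFieldNormedType.Exports.

#[global] Open Scope classical_set_scope.
#[global] Open Scope ring_scope.

(* Finite nonempty types: the chosen point is only a witness of nonemptiness,
   and makes the sample space below an instance of measurableType. *)
#[short(type="finPointedType")]
HB.structure Definition FinPointed := {T of Finite T & Pointed T}.

Record dist (R : realType) (E : finType) := Dist {
  dist_fun :> E -> R ;
  dist_ge0 : forall x, 0 <= dist_fun x ;
  dist_sum1 : \sum_x dist_fun x = 1 }.

(* Q t j i a b stands for Q(t,j|i,a,b); only its values for t >= 0 matter. *)
Record semi_markov_kernel (R : realType) (S A B : finType)
    (Q : R -> S -> S -> A -> B -> R) : Prop := {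
  smk_nondecreasing : forall i j a b (s t : R),
    0 <= s -> s <= t -> Q s j i a b <= Q t j i a b ;
  smk_right_continuous : forall i j a b (t : R), 0 <= t ->
    Q s j i a b @[s --> t^'+] --> Q t j i a b ;
  smk_ge0 : forall i j a b (t : R), 0 <= t -> 0 <= Q t j i a b ;
  smk_at0 : forall i j a b, Q 0 j i a b = 0 ;
  smk_sum_le1 : forall i a b (t : R), 0 <= t -> \sum_j Q t j i a b <= 1 ;
  smk_sum_lim : forall i a b,
    \sum_j lim (Q t j i a b @[t --> +oo]) = 1 }.

Definition sojourn_cdf (R : realType) (S A B : finType)
    (Q : R -> S -> S -> A -> B -> R) (t : R) (i : S) (a : A) (b : B) : R :=
  \sum_j Q t j i a b.

Definition history (S A B : finType) (n : nat) : Type :=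
  (n.-tuple (S * A * B) * S)%type.

Definition policy1 (R : realType) (K S A B : finType) : Type :=
  K -> forall n, history S A B n -> dist R A.

Definition policy2 (R : realType) (S A B : finType) : Type :=
  forall n, history S A B n -> dist R B.

Definition dual_policy1 (R : realType) (K S A B : finType) : Type :=
  ((S -> dist R K) * policy1 R K S A B)%type.

(* (k, w) with w n = (i_n, a_n, b_n, t_(n+1)) *)
Definition path_space (R : realType) (K S A B : finPointedType) : Type :=
  (K * (nat -> S * A * B * {nonneg R}))%type.

HB.instance Definition _ (R : realType) (K S A B : finPointedType) :=
  Choice.on (path_space R K S A B).
HB.instance Definition _ (R : realType) (K S A B : finPointedType) :=
  isPointed.Build (path_space R K S A B)
    (point, fun=> (point, point, point, NngNum (lexx (0 : R)))).

Section processes.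
Variables (R : realType) (K S A B : finPointedType).
Implicit Type w : path_space R K S A B.

Definition game_type w : K := w.1.
Definition state n w : S := (w.2 n).1.1.1.
Definition act1 n w : A := (w.2 n).1.1.2.
Definition act2 n w : B := (w.2 n).1.2.
(* t_(n+1) *)
Definition sojourn n w : R := (w.2 n).2%:num.
Definition jump_time n w : R := \sum_(m < n) sojourn m w.
Definition hist n w : history S A B n :=
  ([tuple (state m w, act1 m w, act2 m w) | m < n], state n w).
Definition explosion_time w : \bar R :=
  lim ((jump_time n w)%:E @[n --> \oo]).

(* The unique n with T_n <= t < T_(n+1) when 0 <= t < T_oo (junk otherwise). *)
Definition epoch w (t : R) : nat :=
  xget 0%N [set n | jump_time n w <= t < jump_time n.+1 w].

Definition state_at w t : S := state (epoch w t) w.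
Definition act1_at w t : A := act1 (epoch w t) w.
Definition act2_at w t : B := act2 (epoch w t) w.

(* Generators of the product sigma-algebra; the finite factors are discrete. *)
Definition cylinders : set (set (path_space R K S A B)) :=
  [set E | (exists k, E = [set w | game_type w = k]) \/
    (exists n s, E = [set w | state n w = s]) \/
    (exists n a, E = [set w | act1 n w = a]) \/
    (exists n b, E = [set w | act2 n w = b]) \/
    (exists n (Y : set R), measurable Y /\ E = [set w | Y (sojourn n w)])].

Definition Omega := g_sigma_algebraType cylinders.

(* Generators of sigma(kappa, H_n, T_n). *)
Definition past n : set (set Omega) :=
  [set E | exists k (h : history S A B n) (Y : set R), measurable Y /\
    E = [set w | game_type w = k /\ hist n w = h /\ Y (jump_time n w)]].

(* Generators of sigma(kappa, H_n, T_n, A_n, B_n). *)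
Definition past_act n : set (set Omega) :=
  [set E | exists k (h : history S A B n) (Y : set R) a b, measurable Y /\
    E = [set w | game_type w = k /\ hist n w = h /\ Y (jump_time n w) /\
                 act1 n w = a /\ act2 n w = b]].

(* g is a version of the conditional probability P(F | sigma(G)). *)
Definition is_cond_prob (P : probability Omega R) (F : set Omega)
    (G : set (set Omega)) (g : Omega -> R) : Prop :=
  (forall Y : set R, measurable Y -> <<s G >> (g @^-1` Y)) /\
  (forall E : set Omega, <<s G >> E ->
    P (E `&` F) = \int[P]_(w in E) (g w)%:E)%E.

Record game_law (Q : R -> S -> S -> A -> B -> R) (p : dist R K) (i : S)
    (pi : policy1 R K S A B) (sg : policy2 R S A B)
    (P : probability Omega R) : Prop := {
  law_init : forall k,
    P [set w | state 0 w = i /\ game_type w = k] = (p k)%:E ;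
  law_act : forall n a b,
    is_cond_prob P [set w | act1 n w = a /\ act2 n w = b] (past n)
      (fun w => pi (game_type w) n (hist n w) a * sg n (hist n w) b) ;
  law_jump : forall n (t : R) j, 0 <= t ->
    is_cond_prob P
      [set w | jump_time n.+1 w - jump_time n w <= t /\ state n.+1 w = j]
      (past_act n)
      (fun w => Q t j (state n w) (act1 n w) (act2 n w)) }.

Definition laws := dist R K -> S -> policy1 R K S A B -> policy2 R S A B ->
  probability Omega R.

Definition discounted (alpha : R) (r : K -> S -> A -> B -> R) w : \bar R :=
  (\int[lebesgue_measure]_(t in
      [set t : R | (0 <= t)%R /\ t%:E < explosion_time w])
    (expR (- (alpha * t)) *
       r (game_type w) (state_at w t) (act1_at w t) (act2_at w t))%:E)%E.

Section values.
Variables (P : laws) (alpha : R) (c : K -> S -> A -> B -> R).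

Definition payoff (p : dist R K) (i : S) (pi : policy1 R K S A B)
    (sg : policy2 R S A B) : \bar R :=
  (\int[P p i pi sg]_w discounted alpha c w)%E.

Definition lower_value (p : dist R K) (i : S) : \bar R :=
  ereal_sup (range (fun pi => ereal_inf (range (payoff p i pi)))).

Definition upper_value (p : dist R K) (i : S) : \bar R :=
  ereal_inf (range (fun sg => ereal_sup (range (fun pi => payoff p i pi sg)))).

Definition dual_payoff (z : K -> R) (i : S) (hpi : dual_policy1 R K S A B)
    (sg : policy2 R S A B) : \bar R :=
  (\int[P (hpi.1 i) i hpi.2 sg]_w
    discounted alpha (fun k s a b => (c k s a b - z k)%R) w)%E.

Definition dual_lower_value (z : K -> R) (i : S) : \bar R :=
  ereal_sup (range (fun hpi => ereal_inf (range (dual_payoff z i hpi)))).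

Definition dual_upper_value (z : K -> R) (i : S) : \bar R :=
  ereal_inf
    (range (fun sg => ereal_sup (range (fun hpi => dual_payoff z i hpi sg)))).

End values.

(* The base value 0 of the maximum is harmless since c >= 0. *)
Definition max_rate (c : K -> S -> A -> B -> R) : R :=
  \big[Num.max/0]_(x : K * S * A * B) c x.1.1.1 x.1.1.2 x.1.2 x.2.

Definition rate_box (c : K -> S -> A -> B -> R) : set (K -> R) :=
  [set z | forall k, 0 <= z k <= max_rate c].

End processes.

Definition pairing (R : realType) (K : finType) (p : dist R K) (z : K -> R) : R :=
  \sum_k p k * z k.

Definition is_max (R : realType) (Y : set (\bar R)) (v : \bar R) : Prop :=
  Y v /\ ubound Y v.

Definition is_min (R : realType) (Y : set (\bar R)) (v : \bar R) : Prop :=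
  Y v /\ lbound Y v.

(* Main.v *)
Require Import Defs.
From mathcomp Require Import ring lra measurable_realfun.

(** Integrating e^{-alpha t} against the jump times turns the expected payoff
    into a series: the discounted probability that type k and history h are
    realised is p(k) times a realisation weight of Player 1's policy for type k,
    times one of Player 2's policy, times a weight depending only on Q.  Hence
    the payoff is sum_k p(k) v(k, pi^k, sigma) with v bounded by c^*/alpha, and
    by Kuhn's argument probabilistic mixtures of policies of either player are
    realised by policies.  The bound on D makes the expected discount at the
    n-th jump decay geometrically, so that the dual payoff is the payoff minus
    <p,z>/alpha.

    What remains is convex duality.  Both value functions are concave in p (by
    splitting for the lower one, as an infimum of linear functions for the upper
    one) and increase at rates between 0 and c^*/alpha, which yields
    supergradients in a box; the maxima over p come from a minimax theorem on
    the simplex. *)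

Set Implicit Arguments.
Unset Strict Implicit.
Unset Printing Implicit Defensive.

(** * A minimax theorem on compact convex sets *)

(** Policy spaces carry no topology here and extrema over policies need not be attained; all
    compactness lies in the finite-dimensional sets of priors and of vectors z. One minimax theorem,
    for affine forms on a compact convex set, is used in two ways: on the box it produces
    supergradients, on the simplex maximising priors. The lower and the upper value are never
    compared with each other. For the upper one, mixing Player 2's policies makes the family of
    best-reply payoffs convex; the lower one has an infimum inside a supremum and offers no such
    family, so its affine majorants take that place. The box has side c^*/alpha because the payoff
    of each type lies between 0 and that number; the substitution z = alpha y turns it into the set
    B of the statement. The law of the process is known only through conditional probabilities, that
    is, through distribution functions of jump and sojourn times, which is why exponentials are
    rewritten as integrals over half-lines. *)

Lemma sum_continuous (R : realType) (T : topologicalType) (I : Type)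
    (r : seq I) (f : I -> T -> R) :
  (forall i, continuous (f i)) -> continuous (fun x => \sum_(i <- r) f i x).
Proof.
move=> cf; apply: continuous_big => [|i _]; last exact: cf.
exact: add_continuous.
Qed.

Section minimax.
Variables (R : realType) (K : finType).
Local Notation point_space := {ptws K -> R}.

Definition affine_form (f : (K -> R) * R) (x : K -> R) : R :=
  \sum_k f.1 k * x k + f.2.

Definition mix (l : R) (x y : K -> R) : K -> R :=
  fun k => l * x k + (1 - l) * y k.

Lemma affine_form_mix f l x y :
  affine_form f (mix l x y) = l * affine_form f x + (1 - l) * affine_form f y.
Proof.
rewrite /affine_form /mix 2!mulrDr addrACA !mulr_sumr -big_split /=.
congr (_ + _); last by ring.
by apply: eq_bigr => k _; ring.
Qed.

Lemma affine_form_continuous f :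
  continuous (fun x : point_space => affine_form f x).
Proof.
pose coord k (x : point_space) : R := (x : K -> R) k.
have cc k : continuous (coord k) by exact: (@proj_continuous K (fun=> R)).
have sc : continuous (fun x : point_space => \sum_k f.1 k * coord k x).
  apply: sum_continuous => k x.
  apply: (@continuousM R point_space (fun=> f.1 k) (coord k)); last exact: cc.
  exact: (@cst_continuous point_space R).
move=> x.
apply: (@continuousD R R^o point_space
  (fun x => \sum_k f.1 k * coord k x) (fun=> f.2)); first exact: sc.
exact: (@cst_continuous point_space R).
Qed.

Variables (X : set point_space) (F : set ((K -> R) * R)).
Hypothesis X0 : X !=set0.
Hypothesis cptX : compact X.
Hypothesis convX : forall l x y, 0 <= l <= 1 -> X x -> X y -> X (mix l x y).
(** Convexity only up to domination: the best reply to a mixture of two policies earns at most the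
    mixture of the two best-reply payoffs, so equality would be too much to ask. *)
Hypothesis convF : forall l f g, 0 <= l <= 1 -> F f -> F g ->
  exists2 h, F h & forall x, X x ->
    affine_form h x <= l * affine_form f x + (1 - l) * affine_form g x.
Hypothesis F_nonneg : forall f, F f -> exists2 x, X x & 0 <= affine_form f x.

(** Iterates the two-point hypothesis [convF]. Keeping the weights unnormalised lets the induction
    peel off one term at a time; the only division is by the positive total. *)
Lemma weighted_combination (s : seq ((K -> R) * R)) (w : (K -> R) * R -> R) :
  (forall f, f \in s -> F f /\ 0 <= w f) -> 0 < \sum_(f <- s) w f ->
  exists2 h, F h & forall x, X x ->
    (\sum_(f <- s) w f) * affine_form h x <=
    \sum_(f <- s) w f * affine_form f x.
Proof.
elim: s => [|f s IH] sF; first by rewrite big_nil ltxx.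
rewrite big_cons => W0.
have [Ff wf0] := sF f (mem_head _ _).
have {}sF g : g \in s -> F g /\ 0 <= w g.
  by move=> gs; apply: sF; rewrite in_cons gs orbT.
have [ws0|ws0] := ltP 0 (\sum_(g <- s) w g); last first.
  have z g : g \in s -> w g = 0.
    move=> gs; have : \sum_(g <- s) w g == 0.
      by rewrite eq_le ws0 big_seq sumr_ge0// => i /sF[].
    rewrite big_seq psumr_eq0; last by move=> i /sF[].
    by move=> /allP/(_ _ gs); rewrite gs => /eqP.
  have -> : \sum_(g <- s) w g = 0 by rewrite big_seq big1.
  exists f => // x Xx; rewrite addr0 big_cons [X in _ + X]big_seq big1 ?addr0//.
  by move=> g gs; rewrite z// mul0r.
have [h Fh hP] := IH sF ws0.
set S := \sum_(g <- s) w g in W0 ws0 hP *.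
have [g Fg gP] : exists2 g, F g & forall x, X x -> affine_form g x <=
    w f / (w f + S) * affine_form f x + (1 - w f / (w f + S)) * affine_form h x.
  apply: convF => //; rewrite divr_ge0 ?(ltW W0)//=.
  by rewrite ler_pdivrMr// mul1r lerDl ltW.
exists g => // x Xx; rewrite big_cons.
apply: (@le_trans _ _ (w f * affine_form f x + S * affine_form h x)).
  have -> : w f * affine_form f x + S * affine_form h x = (w f + S) *
   (w f / (w f + S) * affine_form f x + (1 - w f / (w f + S)) * affine_form h x).
    by field; rewrite gt_eqF.
  by rewrite ler_wpM2l ?(ltW W0)// gP.
by rewrite lerD2l hP.
Qed.

(* The minimiser x0 of the penalty sum_f (f^-)^2 is a common point: otherwise
   the combination of the f with weights f^-(x0) would be negative on X. *)
Lemma finite_minimax (s : seq ((K -> R) * R)) : (forall f, f \in s -> F f) ->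
  exists2 x, X x & forall f, f \in s -> 0 <= affine_form f x.
Proof.
move=> sF.
pose neg f (x : K -> R) := Num.max 0 (- affine_form f x).
pose pen (x : point_space) := \sum_(f <- s) neg f x ^+ 2.
have neg_ge0 f x : 0 <= neg f x by rewrite le_max lexx.
have cpen : continuous pen.
  apply: sum_continuous => f x.
  have cneg : {for x, continuous (fun y : point_space => neg f y)}.
    rewrite /neg.
    apply: (@continuous_max R point_space (fun=> 0) (fun y => - affine_form f y)).
      exact: (@cst_continuous point_space R).
    by apply: continuousN; exact: affine_form_continuous.
  exact: (continuousM cneg cneg).
have [x0 + x0min] := compact_EVT_min X0 cptX (continuous_subspaceT cpen).
rewrite inE => Xx0.
have [pos|/existsNP[f0 /not_implyP[f0s /negP f0neg]]] :=
  pselect (forall f, f \in s -> 0 <= affine_form f x0); first by exists x0.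
exfalso; rewrite -ltNge in f0neg.
have W0 : 0 < \sum_(f <- s) neg f x0.
  rewrite lt_def sumr_ge0// andbT psumr_eq0//; apply/allPn; exists f0 => //=.
  by rewrite gt_eqF// lt_max oppr_gt0 f0neg orbT.
have [|h Fh hP] := @weighted_combination s (neg^~ x0) _ W0.
  by move=> f fs; split; [exact: sF|exact: neg_ge0].
have [x Xx hx0] := F_nonneg Fh.
have := hP x Xx; rewrite leNgt => /negP; apply.
apply: lt_le_trans (mulr_ge0 (ltW W0) hx0).
pose D f := affine_form f x - affine_form f x0.
(* Since f^- f = -(f^-)^2, the weighted sum at [x0] is minus the penalty. *)
have sq : \sum_(f <- s) neg f x0 * affine_form f x0 = - pen x0.
  rewrite -sumrN; apply: eq_bigr => f _; rewrite /neg.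
  by case: (lerP 0 (- affine_form f x0)) => _; ring.
have pen0 : 0 < pen x0.
  rewrite lt_def sumr_ge0 => [|f _]; last exact: sqr_ge0.
  rewrite andbT psumr_eq0 => [|f _]; last exact: sqr_ge0.
  apply/allPn; exists f0 => //=.
  by rewrite sqrf_eq0 gt_eqF// lt_max oppr_gt0 f0neg orbT.
have -> : \sum_(f <- s) neg f x0 * affine_form f x =
    \sum_(f <- s) neg f x0 * D f - pen x0.
  by rewrite -sq -big_split/=; apply: eq_bigr => f _; rewrite /D; ring.
(* It remains to show [G <= 0], the first-order optimality of [x0] in the direction of [x]. *)
rewrite subr_lt0; apply: le_lt_trans pen0.
rewrite leNgt; apply/negP => G0.
set G := \sum_(f <- s) _ in G0.
pose Q := \sum_(f <- s) D f ^+ 2.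
have Q0 : 0 <= Q by apply: sumr_ge0 => f _; exact: sqr_ge0.
(* On the way from [x0] to [x] each f^- is at most |f^-(x0) - t D f|, which bounds the penalty by
   pen x0 - 2tG + t^2 Q. *)
have descent t : 0 <= t <= 1 -> 0 <= t ^+ 2 * Q - t * G *+ 2.
  move=> t01; have := x0min (mix t x x0); rewrite inE => /(_ (convX t01 Xx Xx0)).
  rewrite -subr_ge0 => /le_trans; apply.
  rewrite /pen /Q /G mulr_sumr mulr_sumr -sumrMnl -!sumrB; apply: ler_sum => f _.
  have -> : neg f (mix t x x0) =
      Num.max 0 (- affine_form f x0 - t * D f).
    by rewrite /neg affine_form_mix /D; congr Num.max; ring.
  rewrite /neg; move: (affine_form f x0) (D f) => a d.
  by case: (lerP 0 (- a)) => a0; case: (lerP 0 (- a - t * d)) => b0; nra.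
(* A step with t Q < G, so that t^2 Q - 2tG is negative. *)
pose t := G / (G + Q).
have GQ : 0 < G + Q by rewrite ltr_wpDr.
have t0 : 0 < t by rewrite divr_gt0.
have t1 : t <= 1 by rewrite ler_pdivrMr// mul1r lerDl.
have /descent : 0 <= t <= 1 by rewrite (ltW t0) t1.
have tG : t * (G + Q) = G by rewrite /t; field; rewrite gt_eqF.
by nra.
Qed.

(** The closed sets on which the forms are nonnegative have the finite intersection property in the
    compact [X], by [finite_minimax]; a cluster point of the filter they generate lies in all of
    them. *)
Lemma minimax : exists2 x, X x & forall f, F f -> 0 <= affine_form f x.
Proof.
have [[f0 Ff0]|F00] := pselect (F !=set0); last first.
  by have [y Xy] := X0; exists y => // g Fg; exfalso; apply: F00; exists g.
pose E f : set point_space := X `&` [set x | 0 <= affine_form f x].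
have finIE : finI F E.
  move=> D' D'F; have [|x Xx xP] := @finite_minimax (finmap.enum_fset D').
    by move=> f /D'F; rewrite inE.
  by exists x => f fD'; split => //; exact: xP.
have [|x [Xx xE]] := cptX (finI_filter finIE).
  by exists (E f0); [exact: finI_from1|move=> x []].
exists x => // f Ff.
have /continuous_closedP/(_ _ (@closed_ge R 0)) clf := @affine_form_continuous f.
apply: clf => B xB.
have [|y [[_ fy] By]] := xE (E f) B _ xB; last by exists y.
by exists (E f) => //; exact: finI_from1.
Qed.

End minimax.

(** * Concave functions on the simplex *)

Section sup_inf_range.
Variables (R : realType) (I : Type) (g : I -> R).

(** The real [sup] and [inf] have junk values on empty or unbounded sets, whence the bound [c] and
    the point [i0] in these lemmas. Working in R keeps the duality argument within linear
    arithmetic; [sup_range_EFin] and [inf_range_EFin] lead back to the extended reals. *)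
Lemma le_sup_range c i : (forall j, g j <= c) -> g i <= sup (range g).
Proof.
move=> gc; apply: ub_le_sup; last by exists i.
by exists c => _ [j _ <-]; exact: gc.
Qed.

Lemma sup_range_le c (i0 : I) : (forall j, g j <= c) -> sup (range g) <= c.
Proof.
move=> gc; apply: ge_sup; first by exists (g i0), i0.
by move=> _ [j _ <-]; exact: gc.
Qed.

Lemma inf_range_le c i : (forall j, c <= g j) -> inf (range g) <= g i.
Proof.
move=> gc; apply: ge_inf; last by exists i.
by exists c => _ [j _ <-]; exact: gc.
Qed.

Lemma le_inf_range c (i0 : I) : (forall j, c <= g j) -> c <= inf (range g).
Proof.
move=> gc; apply: lb_le_inf; first by exists (g i0), i0.
by move=> _ [j _ <-]; exact: gc.
Qed.

Lemma sup_range_EFin c (i0 : I) : (forall j, g j <= c) ->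
  ereal_sup (range (fun i => (g i)%:E)) = (sup (range g))%:E.
Proof.
move=> gc; rewrite -ereal_sup_EFin.
- by rewrite image_comp.
- by exists c => _ [j _ <-]; exact: gc.
- by exists (g i0), i0.
Qed.

Lemma inf_range_EFin c (i0 : I) : (forall j, c <= g j) ->
  ereal_inf (range (fun i => (g i)%:E)) = (inf (range g))%:E.
Proof.
move=> gc; rewrite -ereal_inf_EFin.
- by rewrite image_comp.
- by exists c => _ [j _ <-]; exact: gc.
- by exists (g i0), i0.
Qed.

Lemma sup_range_gt c (i0 : I) e : (forall j, g j <= c) -> 0 < e ->
  exists i, sup (range g) - e < g i.
Proof.
move=> gc e0; have [|_ [i _ <-]] := @sup_adherent _ (range g) e e0.
  by split; [exists (g i0), i0|exists c => _ [j _ <-]; exact: gc].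
by exists i.
Qed.

End sup_inf_range.

Section simplex.
Variables (R : realType) (K : finType) (k0 : K).
Implicit Types (p q : dist R K) (x y : K -> R).

(** A set of functions, because the topology and [mix] live on [K -> R]; [simplex_dist] and
    [dist_of_simplex] pass from the records [dist] and back. *)
Definition simplex : set {ptws K -> R} :=
  [set x | (forall k, 0 <= x k) /\ \sum_k x k = 1].

Lemma simplex_dist p : simplex (p : K -> R).
Proof. by split; [exact: dist_ge0|exact: dist_sum1]. Qed.

Lemma dist_of_simplex x : simplex x -> exists p, (p : K -> R) = x.
Proof. by move=> [x0 x1]; exists (Dist x0 x1). Qed.

Lemma simplex_mix l x y : 0 <= l <= 1 -> simplex x -> simplex y ->
  simplex (mix l x y).
Proof.
move=> /andP[l0 l1] [x0 x1] [y0 y1]; split=> [k|].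
  by rewrite /mix addr_ge0// mulr_ge0// subr_ge0.
by rewrite /mix big_split/= -!mulr_sumr x1 y1; ring.
Qed.

Lemma sum_delta : \sum_k (k == k0)%:R = 1 :> R.
Proof. by rewrite (bigD1 k0)//= eqxx big1 ?addr0// => k /negbTE ->. Qed.

Definition delta_dist : dist R K :=
  Dist (fun k => ler0n R (k == k0)) sum_delta.

Lemma simplex0 : simplex !=set0.
Proof. by exists (delta_dist : K -> R); exact: simplex_dist. Qed.

Lemma compact_box (M : R) :
  compact ([set x | forall k, 0 <= x k <= M] : set {ptws K -> R}).
Proof.
have := @tychonoff K (fun=> R) (fun=> `[0, M]%classic) (fun=> @segment_compact R 0 M).
congr compact; apply/seteqP; split=> x /= xP k; have := xP k;
  by rewrite /= in_itv.
Qed.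

Lemma compact_simplex : compact simplex.
Proof.
have -> : simplex = [set x : {ptws K -> R} | forall k, 0 <= x k <= 1] `&`
    (fun x : {ptws K -> R} => affine_form (fun=> 1, 0) x) @^-1` [set 1].
  rewrite /affine_form /=; apply/seteqP; split=> x /= [x0 x1].
    split=> [k|]; last by rewrite addr0 -[RHS]x1; apply: eq_bigr => k _; rewrite mul1r.
    rewrite x0/= -x1 (bigD1 k)//= lerDl sumr_ge0// => i _; exact: x0.
  split=> [k|]; first by have /andP[] := x0 k.
  by rewrite -x1 addr0; apply: eq_bigr => k _; rewrite mul1r.
apply: compact_closedI; first exact: compact_box.
have /continuous_closedP := @affine_form_continuous R K (fun=> 1, 0).
by apply; exact: closed_eq.
Qed.

Definition dot x y : R := \sum_k x k * y k.

Lemma dotB x y z : dot x (fun k => y k - z k) = dot x y - dot x z.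
Proof. by rewrite /dot -sumrB; apply: eq_bigr => k _; rewrite mulrBr. Qed.

Lemma dot_mix l x y z : dot (mix l x y) z = l * dot x z + (1 - l) * dot y z.
Proof.
by rewrite /dot !mulr_sumr -big_split; apply: eq_bigr => k _; rewrite /mix/=; ring.
Qed.

Lemma dot_mixr l x y z : dot z (mix l x y) = l * dot z x + (1 - l) * dot z y.
Proof.
by rewrite /dot !mulr_sumr -big_split; apply: eq_bigr => k _; rewrite /mix/=; ring.
Qed.

Lemma affine_formE w b x : affine_form (w, b) x = dot x w + b.
Proof. by congr (_ + _); apply: eq_bigr => k _; rewrite mulrC. Qed.

Lemma sum_norm_dist p : \sum_k `|p k| = 1.
Proof.
by rewrite -(dist_sum1 p); apply: eq_bigr => k _; rewrite ger0_norm ?dist_ge0.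
Qed.

Lemma dist_le1 p k : p k <= 1.
Proof.
by rewrite -(dist_sum1 p) (bigD1 k)//= lerDl sumr_ge0// => i _; exact: dist_ge0.
Qed.

Lemma norm_dot_le p y : `|dot p y| <= \sum_k `|y k|.
Proof.
apply: le_trans (ler_norm_sum _ _ _) _; apply: ler_sum => k _.
by rewrite normrM ger0_norm ?dist_ge0// ler_piMl// dist_le1.
Qed.

Lemma dot_le p y : dot p y <= \sum_k `|y k|.
Proof. exact: le_trans (ler_norm _) (norm_dot_le p y). Qed.

Lemma dot_ge p y : - \sum_k `|y k| <= dot p y.
Proof. by have := norm_dot_le p y; rewrite ler_norml => /andP[]. Qed.

(* Supergradients of f at p in the box [0,M]^K exist because the linear form
   M * 1_{q > p} separates q from p at the maximal admissible rate. *)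
Lemma supergradient (M : R) (f : (K -> R) -> R) (p : K -> R) :
  0 <= M ->
  (forall l x y, 0 <= l <= 1 -> simplex x -> simplex y ->
    l * f x + (1 - l) * f y <= f (mix l x y)) ->
  (forall q : K -> R, f q <= f p + M * \sum_k Num.max 0 (q k - p k)) ->
  exists2 y, (forall k, 0 <= y k <= M) &
    forall q : K -> R, simplex q -> f q - dot q y <= f p - dot p y.
Proof.
move=> M0 concf lipf.
(* The unknown is the supergradient [y]: the form attached to [q] is nonnegative at [y] exactly when
   the supergradient inequality holds at [q]. *)
pose form (q : K -> R) : (K -> R) * R := (fun k => q k - p k, f p - f q).
have [|||||y By yP] := @minimax R K [set y | forall k, 0 <= y k <= M]
    [set form q | q in simplex].
- by exists (fun=> 0) => k; rewrite lexx.
- exact: compact_box.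
- move=> l x y /andP[l0 l1] xM yM k.
  have /andP[? ?] := xM k; have /andP[? ?] := yM k.
  by rewrite /mix; apply/andP; split; nra.
- move=> l _ _ l01 [q1 sq1 <-] [q2 sq2 <-]; exists (form (mix l q1 q2)).
    by exists (mix l q1 q2) => //; exact: simplex_mix.
  move=> x _; rewrite !affine_formE.
  have := concf l q1 q2 l01 sq1 sq2.
  have dE (q : K -> R) : dot x (fun k => q k - p k) = dot x q - dot x p by rewrite dotB.
  by rewrite !dE dot_mixr; lra.
- move=> _ [q sq <-]; exists (fun k => if p k < q k then M else 0).
    by move=> k; case: ifP => _; rewrite !lexx ?M0.
  rewrite affine_formE /dot.
  have -> : \sum_k (if p k < q k then M else 0) * (q k - p k) =
      M * \sum_k Num.max 0 (q k - p k).
    rewrite mulr_sumr; apply: eq_bigr => k _.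
    have [pq|qp] := ltP (p k) (q k).
      by rewrite max_r// subr_ge0 ltW.
    by rewrite max_l ?mulr0 ?mul0r// subr_le0.
  by have := lipf q; lra.
- exists y => // q sq; have := yP (form q) (ex_intro2 _ _ q sq erefl).
  rewrite affine_formE.
  have -> : dot y (fun k => q k - p k) = dot y q - dot y p by rewrite dotB.
  have C a b : dot a b = dot b a by apply: eq_bigr => k _; rewrite mulrC.
  by rewrite (C q y) (C p y); lra.
Qed.

End simplex.

(** * Duality for games with bounded, mixable payoffs *)

Section game.
Variables (R : realType) (K : finType) (T Sg : Type) (v : K -> T -> Sg -> R).
Variables (M : R) (k0 : K) (t0 : T) (s0 : Sg).
Hypothesis v_bounded : forall k t s, 0 <= v k t s <= M.
Hypothesis mix1 : forall l t1 t2, 0 <= l <= 1 -> exists t, forall k s,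
  v k t s = l * v k t1 s + (1 - l) * v k t2 s.
Hypothesis mix2 : forall l s1 s2, 0 <= l <= 1 -> exists s, forall k t,
  v k t s = l * v k t s1 + (1 - l) * v k t s2.
Implicit Types (p q : K -> R) (pi : K -> T) (s : Sg) (y : K -> R).

(** [T] consists of the policies for a single type, so Player 1, who knows the type, chooses in
    [K -> T]; [v k t s] is the payoff when the type is k. *)
Definition pay p pi s : R := \sum_k p k * v k (pi k) s.
Definition low p : R := sup (range (fun pi => inf (range (pay p pi)))).
(** The best reply to [s] is found type by type, so the supremum over [pi] becomes linear in the
    prior; see [sup_pay]. *)
Definition best s k : R := sup (range (fun t => v k t s)).
Definition upp p : R := inf (range (fun s => dot p (best s))).
(** [y] plays the role of z/alpha, since a constant rate z(k) costs z(k)/alpha in total. *)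
Definition dual_low y : R :=
  sup (range (fun x : dist R K * (K -> T) =>
    inf (range (fun s => pay x.1 x.2 s - dot x.1 y)))).
Definition dual_upp y : R :=
  inf (range (fun s => sup (range (fun x : dist R K * (K -> T) =>
    pay x.1 x.2 s - dot x.1 y)))).

Local Notation excess p q := (\sum_k Num.max 0 (q k - p k)).

Lemma M_ge0 : 0 <= M.
Proof. by have /andP[/le_trans h /h] := v_bounded k0 t0 s0. Qed.

Lemma best_bounded s k : 0 <= best s k <= M.
Proof.
apply/andP; split.
  apply: (@le_trans _ _ (v k t0 s)); first by have /andP[] := v_bounded k t0 s.
  by apply: (@le_sup_range _ _ (fun t => v k t s) M t0) => t;
    have /andP[] := v_bounded k t s.
by apply: (sup_range_le t0) => t; have /andP[] := v_bounded k t s.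
Qed.

Lemma weighted_bounded p (u : K -> R) : (forall k, 0 <= u k <= M) ->
  `|dot p u| <= M * \sum_k `|p k|.
Proof.
move=> uM; apply: (le_trans (ler_norm_sum _ _ _)).
rewrite mulr_sumr; apply: ler_sum => k _.
have /andP[u0 u1] := uM k.
by rewrite normrM mulrC (ger0_norm u0) ler_wpM2r.
Qed.

(** One-sided: an increased coordinate gains at most M per unit, a decreased one gains nothing, as
    [u] is nonnegative. This is the growth condition that keeps the vector found by [supergradient]
    in the box. *)
Lemma weighted_lipschitz p q (u : K -> R) : (forall k, 0 <= u k <= M) ->
  dot q u <= dot p u + M * excess p q.
Proof.
move=> uM; rewrite mulr_sumr -lerBlDl -sumrB; apply: ler_sum => k _.
have /andP[u0 u1] := uM k; rewrite -mulrBl.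
by have [d0|d0] := lerP 0 (q k - p k); nra.
Qed.

Lemma pay_bounded p pi s : `|pay p pi s| <= M * \sum_k `|p k|.
Proof. by apply: (@weighted_bounded p (fun k => v k (pi k) s)) => k. Qed.

Lemma pay_ge p pi s : - (M * \sum_k `|p k|) <= pay p pi s.
Proof. by have := pay_bounded p pi s; rewrite ler_norml => /andP[]. Qed.

Lemma pay_le p pi s : pay p pi s <= M * \sum_k `|p k|.
Proof. by have := pay_bounded p pi s; rewrite ler_norml => /andP[]. Qed.

Lemma inf_pay_le p pi s : inf (range (pay p pi)) <= pay p pi s.
Proof. by apply: inf_range_le => s'; exact: pay_ge. Qed.

Lemma le_low p pi : inf (range (pay p pi)) <= low p.
Proof.
apply: (@le_sup_range _ _ (fun pi => inf (range (pay p pi)))) => pi'.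
by apply: le_trans (inf_pay_le p pi' s0) (pay_le _ _ _).
Qed.

Lemma low_lipschitz p q : low q <= low p + M * excess p q.
Proof.
apply: (sup_range_le (fun=> t0)) => pi; rewrite -lerBlDr.
apply: le_trans (le_low p pi).
apply: (le_inf_range s0) => s; rewrite lerBlDr.
apply: le_trans (inf_pay_le q pi s) _.
exact: (@weighted_lipschitz p q (fun k => v k (pi k) s)).
Qed.

(* Splitting: a mixture of (p,pi) and (q,pi') is played from the mixed prior
   by mixing pi k and pi' k with the posterior weights of p and q given k. *)
Lemma low_concave l p q : 0 <= l <= 1 -> simplex p -> simplex q ->
  l * low p + (1 - l) * low q <= low (mix l p q).
Proof.
move=> /andP[l0 l1] [p0 p1] [q0 q1].
have split pi pi' : exists pi'', forall s,
    pay (mix l p q) pi'' s = l * pay p pi s + (1 - l) * pay q pi' s.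
  pose r k := l * p k / mix l p q k.
  have mk k : 0 <= mix l p q k by rewrite addr_ge0 ?mulr_ge0 ?subr_ge0.
  have /choice[pi'' pi''P] k : exists t, forall s, mix l p q k * v k t s =
      l * (p k * v k (pi k) s) + (1 - l) * (q k * v k (pi' k) s).
    have a0 : 0 <= l * p k by rewrite mulr_ge0.
    have b0 : 0 <= (1 - l) * q k by rewrite mulr_ge0 ?subr_ge0.
    have [z|nz] := eqVneq (mix l p q k) 0.
      (* Both contributions of type k vanish, so any policy will do for it. *)
      exists t0 => s; rewrite z mul0r !mulrA.
      have /eqP : l * p k + (1 - l) * q k = 0 by [].
      by rewrite paddr_eq0// => /andP[/eqP -> /eqP ->]; rewrite !mul0r addr0.
    have mpos : 0 < mix l p q k by rewrite lt_def nz mk.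
    have [|t tP] := @mix1 (r k) (pi k) (pi' k).
      by rewrite /r divr_ge0//= ler_pdivrMr// mul1r lerDl.
    exists t => s; rewrite tP /r; move: nz; rewrite /mix => nz.
    by field.
  exists pi'' => s; rewrite /pay !mulr_sumr -big_split; apply: eq_bigr => k _.
  by rewrite pi''P.
apply/ler_addgt0Pr => e e0.
have inf_le x pi : inf (range (pay x pi)) <= M * \sum_k `|x k|.
  exact: le_trans (inf_pay_le x pi s0) (pay_le _ _ _).
have [pi piP] := sup_range_gt (fun=> t0) (inf_le p) e0.
have [pi' pi'P] := sup_range_gt (fun=> t0) (inf_le q) e0.
rewrite -/(low p) in piP; rewrite -/(low q) in pi'P.
have [pi'' pi''P] := split pi pi'.
suff : l * inf (range (pay p pi)) + (1 - l) * inf (range (pay q pi')) <=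
    low (mix l p q) by nra.
apply: le_trans (le_low _ pi'').
apply: (le_inf_range s0) => s; rewrite pi''P.
by rewrite lerD// ler_wpM2l ?subr_ge0// inf_pay_le.
Qed.

Lemma inf_dual p pi y : inf (range (fun s => pay p pi s - dot p y)) =
  inf (range (pay p pi)) - dot p y.
Proof.
apply/eqP; rewrite eq_le; apply/andP; split.
  rewrite lerBrDr; apply: (le_inf_range s0) => s; rewrite -lerBrDr.
  apply: (inf_range_le (c := - (M * \sum_k `|p k|) - dot p y)) => s'.
  by rewrite lerD2r pay_ge.
by apply: (le_inf_range s0) => s; rewrite lerD2r inf_pay_le.
Qed.

(** With [dual_low_le], an exchange of suprema: choosing prior and policy together amounts to
    choosing the prior and then earning [low p - dot p y]. Attainment is a separate matter. *)
Lemma le_dual_low y p : simplex p -> low p - dot p y <= dual_low y.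
Proof.
move=> sp; have [p' p'E] := dist_of_simplex sp.
rewrite lerBlDr; apply: (sup_range_le (fun=> t0)) => pi.
rewrite -lerBlDr -inf_dual -p'E.
apply: (@le_sup_range _ _ (fun x : dist R K * (K -> T) =>
  inf (range (fun s => pay x.1 x.2 s - dot x.1 y))) (M + \sum_k `|y k|) (p', pi)).
move=> -[q pi'] /=; rewrite inf_dual.
have := le_trans (inf_pay_le q pi' s0) (pay_le _ _ _).
by rewrite sum_norm_dist mulr1; have := dot_ge q y; lra.
Qed.

Lemma dual_low_le y c : (forall p, simplex p -> low p - dot p y <= c) ->
  dual_low y <= c.
Proof.
move=> h; pose p' := delta_dist R k0.
apply: (sup_range_le (p', fun=> t0)) => -[q pi] /=; rewrite inf_dual.
by apply: le_trans (h q (simplex_dist q)); rewrite lerD2r le_low.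
Qed.

(* The supremum is attained because all affine majorants of the concave
   function have a common point where they are at least that supremum. *)
Lemma dual_low_maximum y : exists p : dist R K, dual_low y = low p - dot p y.
Proof.
have [|||||p sp pP] := @minimax R K (@simplex R K) [set g | forall x : K -> R,
    simplex x -> low x - dot x y - dual_low y <= affine_form g x].
- exact: simplex0.
- exact: compact_simplex.
- exact: simplex_mix.
- move=> l [w b] [w' b'] /andP[l0 l1] gP g'P.
  exists (mix l w w', l * b + (1 - l) * b') => x sx; last first.
    by rewrite !affine_formE dot_mixr; lra.
  have := gP x sx; have := g'P x sx.
  by rewrite !affine_formE dot_mixr => h1 h2; nra.
- move=> g gP.
  have [x + xP] := compact_EVT_max (simplex0 R k0) (@compact_simplex R K)
    (continuous_subspaceT (@affine_form_continuous R K g)).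
  rewrite inE => sx; exists x => //.
  (* If the majorant [g] had a negative maximum, [low q - dot q y] would stay below [dual_low y] by
     a fixed margin, against the definition of the supremum. *)
  suff : dual_low y <= affine_form g x + dual_low y by lra.
  apply: dual_low_le => q sq; rewrite -lerBlDr.
  by apply: le_trans (gP q sq) (xP q _); rewrite inE.
have [p' p'E] := dist_of_simplex sp.
exists p'; rewrite p'E; apply/eqP; rewrite eq_le le_dual_low// andbT.
(* A supergradient at [p] gives an affine majorant that is tight at [p], so the bound for majorants
   becomes one for [low p]. *)
have [z _ zP] := supergradient M_ge0 low_concave (low_lipschitz p).
have /(pP (fun k => z k - y k, low p - dot p z - dual_low y)) :
    forall x : K -> R, simplex x -> low x - dot x y - dual_low y <=
    affine_form (fun k => z k - y k, low p - dot p z - dual_low y) x.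
  by move=> x sx; rewrite affine_formE dotB; have := zP x sx; lra.
by rewrite affine_formE dotB; lra.
Qed.

(** The inequality for all y is [le_dual_low] rearranged. For equality take y a supergradient of
    [low] at [p]: then [low q - dot q y] is maximal over the simplex at q = p. *)
Lemma low_minimum p : simplex p ->
  (forall y, low p <= dual_low y + dot p y) /\
  exists2 y, (forall k, 0 <= y k <= M) & low p = dual_low y + dot p y.
Proof.
move=> sp; have le_low y : low p <= dual_low y + dot p y.
  by rewrite -lerBlDr le_dual_low.
split=> //.
have [y yM yP] := supergradient M_ge0 low_concave (low_lipschitz p).
exists y => //; apply/eqP; rewrite eq_le le_low/=.
have [q ->] := dual_low_maximum y.
by rewrite -lerBrDr; apply: yP; exact: simplex_dist.
Qed.

Lemma le_best s t k : v k t s <= best s k.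
Proof.
apply: (@le_sup_range _ _ (fun t => v k t s) M t) => t'.
by have /andP[] := v_bounded k t' s.
Qed.

Lemma best_approx s e : 0 < e -> exists pi, forall k, best s k - e < v k (pi k) s.
Proof.
move=> e0; have /choice[pi piP] k : exists t, best s k - e < v k t s.
  apply: (@sup_range_gt _ _ (fun t => v k t s) M t0) => // t.
  by have /andP[] := v_bounded k t s.
by exists pi.
Qed.

(** Suprema need not be attained: e-optimal replies for the single types are pasted into one policy,
    at a total loss of e since the prior sums to one. *)
Lemma sup_pay p s : simplex p ->
  sup (range (fun pi => pay p pi s)) = dot p (best s).
Proof.
move=> [p0 p1]; apply/eqP; rewrite eq_le; apply/andP; split.
  by apply: (sup_range_le (fun=> t0)) => pi; apply: ler_sum => k _;
    rewrite ler_wpM2l// le_best.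
apply/ler_addgt0Pr => e e0; have [pi piP] := best_approx s e0.
apply: (@le_trans _ _ (pay p pi s + e)).
  rewrite -[e in leRHS]mul1r -p1 mulr_suml -big_split; apply: ler_sum => k _ /=.
  by rewrite -mulrDr ler_wpM2l// -lerBlDr ltW.
rewrite lerD2r; apply: (@le_sup_range _ _ (fun pi => pay p pi s)) => pi'.
exact: pay_le.
Qed.

Lemma upp_le p s : upp p <= dot p (best s).
Proof.
apply: (@inf_range_le _ _ (fun s => dot p (best s)) (- (M * \sum_k `|p k|))) => s'.
have := @weighted_bounded p (best s') (best_bounded s').
by rewrite ler_norml => /andP[].
Qed.

Lemma upp_lipschitz p q : upp q <= upp p + M * excess p q.
Proof.
rewrite -lerBlDr; apply: (le_inf_range s0) => s; rewrite lerBlDr.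
apply: le_trans (upp_le q s) _.
by apply: weighted_lipschitz; exact: best_bounded.
Qed.

Lemma upp_concave l p q : 0 <= l <= 1 -> simplex p -> simplex q ->
  l * upp p + (1 - l) * upp q <= upp (mix l p q).
Proof.
move=> /andP[l0 l1] _ _; apply: (le_inf_range s0) => s.
by rewrite dot_mix lerD// ler_wpM2l ?subr_ge0// upp_le.
Qed.

Lemma dual_upp_le y s c :
  (forall p, simplex p -> dot p (best s) - dot p y <= c) -> dual_upp y <= c.
Proof.
move=> h; apply: (@le_trans _ _ (sup (range (fun x : dist R K * (K -> T) =>
    pay x.1 x.2 s - dot x.1 y)))); last first.
  pose p' := delta_dist R k0.
  apply: (sup_range_le (p', fun=> t0)) => -[q pi] /=.
  apply: le_trans (h q (simplex_dist q)); rewrite lerD2r.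
  by apply: ler_sum => k _; rewrite ler_wpM2l ?dist_ge0 ?le_best.
pose p' := delta_dist R k0.
apply: (@inf_range_le _ _ _ (- M - \sum_k `|y k|)) => s'.
apply: (@le_trans _ _ (pay p' (fun=> t0) s' - dot p' y)).
  by rewrite lerB ?dot_le// (le_trans _ (pay_ge _ _ _))// sum_norm_dist mulr1.
apply: (@le_sup_range _ _ (fun x : dist R K * (K -> T) =>
    pay x.1 x.2 s' - dot x.1 y) (M + \sum_k `|y k|) (p', fun=> t0)) => -[q pi] /=.
by have := pay_le q pi s'; have := dot_ge q y; rewrite sum_norm_dist mulr1; lra.
Qed.

Lemma le_dual_upp y p : simplex p -> upp p - dot p y <= dual_upp y.
Proof.
move=> sp; have [p' p'E] := dist_of_simplex sp.
apply: (le_inf_range s0) => s.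
apply: (@le_trans _ _ (dot p (best s) - dot p y)).
  by rewrite lerD2r upp_le.
rewrite -sup_pay// lerBlDr; apply: (sup_range_le (fun=> t0)) => pi.
rewrite -lerBlDr -p'E.
apply: (@le_sup_range _ _ (fun x : dist R K * (K -> T) =>
    pay x.1 x.2 s - dot x.1 y) (M + \sum_k `|y k|) (p', pi)) => -[q pi'] /=.
by have := pay_le q pi' s; have := dot_ge q y; rewrite sum_norm_dist mulr1; lra.
Qed.

(** Minimax between the prior and Player 2's policy: the form of s is what best replies to s earn
    beyond [dual_upp y]. Each s admits a prior where this is nonnegative because [dual_upp y] is an
    infimum over s, and the family is convex up to domination by [mix2]. *)
Lemma dual_upp_maximum y : exists p : dist R K, dual_upp y = upp p - dot p y.
Proof.
pose form s : (K -> R) * R := (fun k => best s k - y k, - dual_upp y).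
have formE s x : affine_form (form s) x = dot x (best s) - dot x y - dual_upp y.
  by rewrite affine_formE -dotB.
have [|||||p sp pP] := @minimax R K (@simplex R K) (range form).
- exact: simplex0.
- exact: compact_simplex.
- exact: simplex_mix.
- move=> l _ _ l01 [s1 _ <-] [s2 _ <-].
  have [s sP] := mix2 s1 s2 l01; exists (form s); first by exists s.
  move=> x [x0 x1]; rewrite !formE.
  suff : dot x (best s) <= l * dot x (best s1) + (1 - l) * dot x (best s2) by lra.
  rewrite /dot !mulr_sumr -big_split; apply: ler_sum => k _ /=.
  rewrite mulrCA [(1 - l) * _]mulrCA -mulrDr ler_wpM2l//.
  apply: (sup_range_le t0) => t; rewrite sP.
  by move: l01 => /andP[? ?]; rewrite lerD// ler_wpM2l ?subr_ge0// le_best.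
- move=> _ [s _ <-].
  have [x + xP] := compact_EVT_max (simplex0 R k0) (@compact_simplex R K)
    (continuous_subspaceT (@affine_form_continuous R K (form s))).
  rewrite inE => sx; exists x => //; rewrite formE subr_ge0.
  apply: (@dual_upp_le _ s) => q sq.
  by have := xP q; rewrite inE !formE lerD2r; exact.
have [p' p'E] := dist_of_simplex sp.
exists p'; rewrite p'E; apply/eqP; rewrite eq_le le_dual_upp// andbT.
rewrite lerBrDr; apply: (le_inf_range s0) => s.
by have := pP (form s) (ex_intro2 _ _ s I erefl); rewrite formE; lra.
Qed.

Lemma upp_minimum p : simplex p ->
  (forall y, upp p <= dual_upp y + dot p y) /\
  exists2 y, (forall k, 0 <= y k <= M) & upp p = dual_upp y + dot p y.
Proof.
move=> sp; have le_upp y : upp p <= dual_upp y + dot p y.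
  by rewrite -lerBlDr le_dual_upp.
split=> //.
have [y yM yP] := supergradient M_ge0 upp_concave (upp_lipschitz p).
exists y => //; apply/eqP; rewrite eq_le le_upp/=.
have [q ->] := dual_upp_maximum y.
by rewrite -lerBrDr; apply: yP; exact: simplex_dist.
Qed.

End game.

(** * Realisation weights of policies *)

Lemma tuple_rconsP (T : Type) n (l : n.+1.-tuple T) (l' : n.-tuple T) (x : T) :
  (forall m : 'I_n, tnth l (widen_ord (leqnSn n) m) = tnth l' m) ->
  tnth l ord_max = x -> l = [tuple of rcons l' x].
Proof.
move=> ll' lx; apply: eq_from_tnth => m; rewrite [RHS](tnth_nth x).
rewrite [RHS](_ : _ = nth x (rcons l' x) m)// nth_rcons size_tuple.
have [mn|nm] := ltnP m n.
  transitivity (tnth l' (Ordinal mn)); last by rewrite (tnth_nth x).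
  by rewrite -ll'; congr tnth; exact/val_inj.
have -> : m = ord_max.
  by apply: val_inj; apply/eqP; rewrite eqn_leq /= nm andbT; have := ltn_ord m.
by rewrite /= eqxx.
Qed.

Section histories.
Variables (S A B : finType).
Local Notation hist n := (n.-tuple (S * A * B) * S)%type.

Definition last_step n (h : hist n.+1) : S * A * B := tnth h.1 ord_max.

(** The state before the last step is recorded in that step and becomes the current state of the
    shortened history. *)
Definition init_hist n (h : hist n.+1) : hist n :=
  ([tuple tnth h.1 (widen_ord (leqnSn n) m) | m < n], (last_step h).1.1).

Definition extend n (h : hist n) (a : A) (b : B) (j : S) : hist n.+1 :=
  ([tuple of rcons h.1 (h.2, a, b)], j).

Lemma last_step_extend n (h : hist n) a b j :
  last_step (extend h a b j) = (h.2, a, b).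
Proof.
by rewrite /last_step (tnth_nth (h.2, a, b))/= nth_rcons size_tuple ltnn eqxx.
Qed.

Lemma init_hist_extend n (h : hist n) a b j : init_hist (extend h a b j) = h.
Proof.
case: h => l x; rewrite /init_hist last_step_extend; congr pair.
apply: eq_from_tnth => m; rewrite tnth_mktuple (tnth_nth (x, a, b)) /=.
by rewrite nth_rcons size_tuple ltn_ord -tnth_nth.
Qed.

Lemma extend_init_hist n (h : hist n.+1) :
  extend (init_hist h) (last_step h).1.2 (last_step h).2 h.2 = h.
Proof.
case: h => l j; rewrite /extend; congr pair; apply/esym/tuple_rconsP.
  by move=> m; rewrite tnth_mktuple.
by rewrite /= /last_step /=; case: (tnth _ _) => -[].
Qed.

Lemma sum_extend (R : realType) n (F : hist n.+1 -> R) :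
  \sum_h F h = \sum_(h : hist n) \sum_a \sum_b \sum_j F (extend h a b j).
Proof.
rewrite (reindex (fun x : hist n * A * B * S => extend x.1.1.1 x.1.1.2 x.1.2 x.2)).
  by rewrite !pair_bigA/=; apply: eq_bigr => -[[[]]].
exists (fun h => (init_hist h, (last_step h).1.2, (last_step h).2, h.2)).
  by move=> [[[h a] b] j] _; rewrite /= init_hist_extend last_step_extend.
by move=> h _; rewrite /= extend_init_hist.
Qed.

End histories.

Section realization_weights.
Variables (R : realType) (S A B C : finType) (act : S * A * B -> C).
Local Notation hist n := (n.-tuple (S * A * B) * S)%type.
Implicit Types pol : forall n, history S A B n -> dist R C.

(** The product of the probabilities that the policy gives to the recorded actions of one player.
    The projection [act] selects the player, so that one definition and one mixing lemma serve
    both. *)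
Fixpoint weight pol n : hist n -> R :=
  match n with
  | 0 => fun=> 1
  | m.+1 => fun h => weight pol (init_hist h) * pol m (init_hist h) (act (last_step h))
  end.

Lemma weight_ge0 pol n (h : hist n) : 0 <= weight pol h.
Proof. by elim: n h => //= n IH h; rewrite mulr_ge0// dist_ge0. Qed.

(* Kuhn: playing pol1 with probability l and pol2 otherwise has the same
   realisation weights as the behaviour policy that mixes them, at each
   history, by the posterior probabilities. *)
Lemma mix_policy l pol1 pol2 : 0 <= l <= 1 ->
  exists pol, forall n (h : hist n),
    weight pol h = l * weight pol1 h + (1 - l) * weight pol2 h /\
    forall c, weight pol h * pol n h c =
      l * (weight pol1 h * pol1 n h c) + (1 - l) * (weight pol2 h * pol2 n h c).
Proof.
move=> /andP[l0 l1].
pose den n (h : hist n) := l * weight pol1 h + (1 - l) * weight pol2 h.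
have a0 n (h : hist n) : 0 <= l * weight pol1 h by rewrite mulr_ge0 ?weight_ge0.
have b0 n (h : hist n) : 0 <= (1 - l) * weight pol2 h.
  by rewrite mulr_ge0 ?weight_ge0 ?subr_ge0.
have post n (h : hist n) : {d : dist R C | forall c, den n h * d c =
    l * (weight pol1 h * pol1 n h c) + (1 - l) * (weight pol2 h * pol2 n h c)}.
  apply/cid; have [z|nz] := eqVneq (den n h) 0.
    (* The mixture reaches [h] with weight zero, so what is played there is immaterial; [pol1] is a
       default. *)
    exists (pol1 n h) => c; rewrite z mul0r !mulrA.
    have /eqP := z; rewrite paddr_eq0// => /andP[/eqP -> /eqP ->].
    by rewrite !mul0r addr0.
  have den0 : 0 < den n h by rewrite lt_def nz addr_ge0.
  pose d c := (l * (weight pol1 h * pol1 n h c) +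
    (1 - l) * (weight pol2 h * pol2 n h c)) / den n h.
  have d0 c : 0 <= d c.
    by rewrite divr_ge0 ?(ltW den0)// !mulrA addr_ge0// mulr_ge0 ?dist_ge0.
  have d1 : \sum_c d c = 1.
    rewrite -mulr_suml big_split/= -!mulr_sumr !dist_sum1 !mulr1.
    by rewrite divff.
  by exists (Dist d0 d1) => c /=; rewrite /d mulrC divfK.
pose pol n h := sval (post n h).
have denE n (h : hist n) : weight pol h = den n h.
  elim: n h => [|n IH] h /=; first by rewrite /den /= !mulr1; ring.
  by rewrite IH (svalP (post n (init_hist h))).
exists pol => n h; split=> [|c]; first exact: denE.
by rewrite denE (svalP (post n h)).
Qed.

End realization_weights.

(** * Discounted occupation measures and payoff series *)

Section value.
Variables (R : realType) (S A B : finType) (i : S).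
Variables (beta : S -> A -> B -> S -> R) (theta alpha : R).
Hypothesis beta_ge0 : forall x a b j, 0 <= beta x a b j.
Hypothesis beta_le : forall x a b, \sum_j beta x a b j <= theta.
Hypothesis theta01 : 0 <= theta < 1.
Hypothesis alpha_gt0 : 0 < alpha.
Local Notation hist n := (n.-tuple (S * A * B) * S)%type.
Implicit Types (t : forall n, history S A B n -> dist R A)
  (s : forall n, history S A B n -> dist R B) (r : S -> A -> B -> R).

(** [beta x a b j] stands for the expected discount over one sojourn on the event that the next
    state is j; this product is the part of a history's discounted probability that no policy
    influences. *)
Fixpoint transition_weight n : hist n -> R :=
  match n with
  | 0 => fun h => (h.2 == i)%:R
  | m.+1 => fun h => transition_weight (init_hist h) *
      beta (last_step h).1.1 (last_step h).1.2 (last_step h).2 h.2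
  end.

Definition history_mass t s n (h : hist n) : R :=
  weight (fun y => y.1.2) t h * weight snd s h * transition_weight h.

Definition occupation t s n (h : hist n) a b : R :=
  history_mass t s h * (t n h a * s n h b).

(** The mean of the integral of e^{-alpha t} over one sojourn of length tau, that is, (1 - E
    e^{-alpha tau}) / alpha. *)
Definition sojourn_weight x a b : R := (1 - \sum_j beta x a b j) / alpha.

Definition stage_payoff r t s n : R :=
  \sum_(h : hist n) \sum_a \sum_b
    occupation t s h a b * (sojourn_weight h.2 a b * r h.2 a b).

Definition value r t s : R := limn (series (stage_payoff r t s)).

Lemma transition_weight_ge0 n (h : hist n) : 0 <= transition_weight h.
Proof. by elim: n h => [|n IH] h /=; [exact: ler0n|rewrite mulr_ge0]. Qed.

Lemma history_mass_ge0 t s n (h : hist n) : 0 <= history_mass t s h.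
Proof. by rewrite !mulr_ge0// ?weight_ge0// transition_weight_ge0. Qed.

Lemma occupation_ge0 t s n (h : hist n) a b : 0 <= occupation t s h a b.
Proof. by rewrite mulr_ge0 ?history_mass_ge0// mulr_ge0// dist_ge0. Qed.

Lemma sojourn_weight_ge0 x a b : 0 <= sojourn_weight x a b.
Proof.
rewrite divr_ge0 ?(ltW alpha_gt0)// subr_ge0 (le_trans (beta_le _ _ _))//.
by have /andP[_ /ltW] := theta01.
Qed.

Lemma history_mass_extend t s n (h : hist n) a b j :
  history_mass t s (extend h a b j) = occupation t s h a b * beta h.2 a b j.
Proof.
rewrite /occupation /history_mass /= init_hist_extend last_step_extend /=.
by ring.
Qed.

Definition total_mass t s n : R := \sum_(h : hist n) history_mass t s h.

Lemma sum_occupation t s n (h : hist n) :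
  \sum_a \sum_b occupation t s h a b = history_mass t s h.
Proof.
under eq_bigr do rewrite -mulr_sumr -mulr_sumr.
by rewrite -mulr_sumr -mulr_suml dist_sum1 dist_sum1 !mulr1.
Qed.

Lemma total_mass0 t s : total_mass t s 0 = 1.
Proof.
rewrite /total_mass (bigD1 ([tuple], i))//= /history_mass /= eqxx !mulr1.
rewrite big1 ?addr0// => -[l x] /=; rewrite (tuple0 l) => /negP xi.
rewrite !mul1r; case: eqP => // xE; exfalso; apply: xi.
by rewrite xE.
Qed.

Lemma total_massS t s n : total_mass t s n.+1 =
  \sum_(h : hist n) \sum_a \sum_b
    occupation t s h a b * \sum_j beta h.2 a b j.
Proof.
rewrite /total_mass sum_extend; apply: eq_bigr => h _; apply: eq_bigr => a _.
apply: eq_bigr => b _; rewrite mulr_sumr; apply: eq_bigr => j _.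
exact: history_mass_extend.
Qed.

Lemma total_mass_ge0 t s n : 0 <= total_mass t s n.
Proof. by apply: sumr_ge0 => h _; exact: history_mass_ge0. Qed.

Lemma total_mass_le t s n : total_mass t s n <= theta ^+ n.
Proof.
elim: n => [|n IH]; first by rewrite total_mass0.
have /andP[th0 _] := theta01.
rewrite total_massS exprS; apply: le_trans (ler_wpM2l th0 IH).
rewrite mulr_sumr; apply: ler_sum => h _; rewrite -sum_occupation.
rewrite mulr_sumr; apply: ler_sum => a _; rewrite mulr_sumr; apply: ler_sum => b _.
by rewrite mulrC ler_wpM2r ?occupation_ge0.
Qed.

(** A constant rate z over one sojourn earns z/alpha times the drop of the discount, so the stages
    telescope. *)
Lemma stage_payoff_cst z t s n : stage_payoff (fun _ _ _ => z) t s n =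
  z / alpha * (total_mass t s n - total_mass t s n.+1).
Proof.
rewrite total_massS /total_mass -sumrB mulr_sumr; apply: eq_bigr => h _.
rewrite -sum_occupation -sumrB mulr_sumr; apply: eq_bigr => a _.
rewrite -sumrB mulr_sumr; apply: eq_bigr => b _.
by rewrite /sojourn_weight; ring.
Qed.

Lemma series_stage_payoff_cst z t s n :
  series (stage_payoff (fun _ _ _ => z) t s) n =
  z / alpha * (1 - total_mass t s n).
Proof.
rewrite /series /=; under eq_bigr do rewrite stage_payoff_cst.
rewrite -mulr_sumr -(total_mass0 t s); congr (_ * _).
rewrite (@telescope_sumr_eq _ 0 n (fun n => - total_mass t s n))// => [|k _].
  by rewrite opprK addrC.
by rewrite opprK addrC.
Qed.

Lemma cvg_stage_payoff_cst z t s :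
  series (stage_payoff (fun _ _ _ => z) t s) @ \oo --> z / alpha.
Proof.
have mass0 : total_mass t s @ \oo --> (0 : R).
  have /andP[th0 th1] := theta01.
  apply: (@squeeze_cvgr _ _ _ _ (fun=> 0) (fun n => theta ^+ n)).
  - by near=> n; rewrite total_mass_ge0 total_mass_le.
  - exact: cvg_cst.
  - by apply: cvg_expr; rewrite ger0_norm.
rewrite (_ : series _ = fun n => z / alpha * (1 - total_mass t s n)); last first.
  by apply/funext => n; exact: series_stage_payoff_cst.
have : z / alpha * (1 - total_mass t s n) @[n --> \oo] --> z / alpha * (1 - 0).
  by apply: cvgM; [exact: cvg_cst|apply: cvgB => //; exact: cvg_cst].
by rewrite subr0 mulr1.
Unshelve. all: by end_near. Qed.

Lemma stage_payoff_ge0 r t s n : (forall x a b, 0 <= r x a b) ->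
  0 <= stage_payoff r t s n.
Proof.
move=> r0; apply: sumr_ge0 => h _; apply: sumr_ge0 => a _; apply: sumr_ge0 => b _.
by rewrite mulr_ge0 ?occupation_ge0// mulr_ge0// sojourn_weight_ge0.
Qed.

Lemma stage_payoff_le r z t s n : (forall x a b, r x a b <= z) ->
  stage_payoff r t s n <= stage_payoff (fun _ _ _ => z) t s n.
Proof.
move=> rz; apply: ler_sum => h _; apply: ler_sum => a _; apply: ler_sum => b _.
by rewrite ler_wpM2l ?occupation_ge0// ler_wpM2l// sojourn_weight_ge0.
Qed.

Lemma stage_payoffB r r' t s n :
  stage_payoff (fun x a b => r x a b - r' x a b) t s n =
  stage_payoff r t s n - stage_payoff r' t s n.
Proof.
rewrite -sumrB; apply: eq_bigr => h _; rewrite -sumrB; apply: eq_bigr => a _.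
by rewrite -sumrB; apply: eq_bigr => b _; ring.
Qed.

Lemma series_stage_payoff_le r z t s n : 0 <= z -> (forall x a b, r x a b <= z) ->
  series (stage_payoff r t s) n <= z / alpha.
Proof.
move=> z0 rz.
apply: (@le_trans _ _ (series (stage_payoff (fun _ _ _ => z) t s) n)).
  by apply: ler_sum => m _; exact: stage_payoff_le.
rewrite series_stage_payoff_cst ler_piMr ?divr_ge0 ?(ltW alpha_gt0)//.
by rewrite gerBl total_mass_ge0.
Qed.

Lemma cvg_value r z t s : 0 <= z -> (forall x a b, 0 <= r x a b <= z) ->
  series (stage_payoff r t s) @ \oo --> value r t s.
Proof.
move=> z0 rz; have r0 x a b : 0 <= r x a b by have /andP[] := rz x a b.
have r1 x a b : r x a b <= z by have /andP[] := rz x a b.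
apply: nondecreasing_is_cvgn.
  by apply: nondecreasing_series => n _ _; exact: stage_payoff_ge0.
by exists (z / alpha) => _ [n _ <-]; exact: series_stage_payoff_le.
Qed.

Lemma value_bounded r z t s : 0 <= z -> (forall x a b, 0 <= r x a b <= z) ->
  0 <= value r t s <= z / alpha.
Proof.
move=> z0 rz; have r0 x a b : 0 <= r x a b by have /andP[] := rz x a b.
have r1 x a b : r x a b <= z by have /andP[] := rz x a b.
have cv := cvg_value (t := t) (s := s) z0 rz.
apply/andP; split.
  apply: limr_ge; first by apply/cvg_ex; exists (value r t s).
  by near=> n; apply: sumr_ge0 => m _; exact: stage_payoff_ge0.
apply: limr_le; first by apply/cvg_ex; exists (value r t s).
by near=> n; exact: series_stage_payoff_le.
Unshelve. all: by end_near. Qed.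

Lemma valueB r r' z z' t s : 0 <= z -> 0 <= z' ->
  (forall x a b, 0 <= r x a b <= z) -> (forall x a b, 0 <= r' x a b <= z') ->
  value (fun x a b => r x a b - r' x a b) t s = value r t s - value r' t s.
Proof.
move=> z0 z'0 rz r'z'; apply: cvg_lim => //.
have -> : series (stage_payoff (fun x a b => r x a b - r' x a b) t s) =
    fun n => series (stage_payoff r t s) n - series (stage_payoff r' t s) n.
  apply/funext => n; rewrite /series /= -sumrB.
  by apply: eq_bigr => k _; rewrite stage_payoffB.
by apply: cvgB; [exact: (cvg_value z0)|exact: (cvg_value z'0)].
Qed.

(** [u] may be of either sign, so [valueB] does not apply; the constant rate is summed exactly by
    telescoping instead. *)
Lemma valueB_cst r z u t s : 0 <= z -> (forall x a b, 0 <= r x a b <= z) ->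
  value (fun x a b => r x a b - u) t s = value r t s - u / alpha.
Proof.
move=> z0 rz; apply: cvg_lim => //.
have -> : series (stage_payoff (fun x a b => r x a b - u) t s) = fun n =>
    series (stage_payoff r t s) n - series (stage_payoff (fun _ _ _ => u) t s) n.
  apply/funext => n; rewrite /series /= -sumrB.
  by apply: eq_bigr => k _; exact: stage_payoffB.
by apply: cvgB; [exact: (cvg_value z0)|exact: cvg_stage_payoff_cst].
Qed.

Lemma value_mix r z l t1 s1 t2 s2 t s : 0 <= z -> (forall x a b, 0 <= r x a b <= z) ->
  (forall n (h : hist n) a b, occupation t s h a b =
    l * occupation t1 s1 h a b + (1 - l) * occupation t2 s2 h a b) ->
  value r t s = l * value r t1 s1 + (1 - l) * value r t2 s2.
Proof.
move=> z0 rz occ; apply: cvg_lim => //.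
have -> : series (stage_payoff r t s) = fun n =>
    l * series (stage_payoff r t1 s1) n + (1 - l) * series (stage_payoff r t2 s2) n.
  apply/funext => n; rewrite /series /= !mulr_sumr -big_split.
  apply: eq_bigr => k _; rewrite /stage_payoff !mulr_sumr -big_split.
  apply: eq_bigr => h _ /=; rewrite !mulr_sumr -big_split.
  apply: eq_bigr => a _ /=; rewrite !mulr_sumr -big_split.
  by apply: eq_bigr => b _ /=; rewrite occ; ring.
apply: cvgD; (apply: cvgM; first exact: cvg_cst); exact: (cvg_value z0).
Qed.

(** The occupation depends on [t] only through the weight of [h] times [t n h a], which [mix_policy]
    makes affine. The mixed policy is chosen before [r] and [s], hence serves all types and all
    opponents at once. *)
Lemma value_mix1 l t1 t2 : 0 <= l <= 1 -> exists t, forall r z s, 0 <= z ->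
  (forall x a b, 0 <= r x a b <= z) ->
  value r t s = l * value r t1 s + (1 - l) * value r t2 s.
Proof.
move=> /(mix_policy (fun y => y.1.2) t1 t2)[t tP]; exists t => r z s z0 rz.
apply: (value_mix z0 rz) => n h a b; rewrite /occupation /history_mass.
have [_ /(_ a) e] := tP n h.
transitivity ((weight (fun y => y.1.2) t h * t n h a) *
  (weight snd s h * transition_weight h * s n h b)); first by ring.
by rewrite e; ring.
Qed.

Lemma value_mix2 l s1 s2 : 0 <= l <= 1 -> exists s, forall r z t, 0 <= z ->
  (forall x a b, 0 <= r x a b <= z) ->
  value r t s = l * value r t s1 + (1 - l) * value r t s2.
Proof.
move=> /(mix_policy snd s1 s2)[s sP]; exists s => r z t z0 rz.
apply: (value_mix z0 rz) => n h a b; rewrite /occupation /history_mass.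
have [_ /(_ b) e] := sP n h.
transitivity ((weight snd s h * s n h b) *
  (weight (fun y => y.1.2) t h * transition_weight h * t n h a)); first by ring.
by rewrite e; ring.
Qed.

End value.

(** * Discounted integrals *)

Section exponential.
Variables (R : realType) (alpha : R).
Hypothesis alpha_gt0 : 0 < alpha.
Local Notation mu := (@lebesgue_measure R).
Implicit Types (a b t : R).

Definition discount t : R := expR (- (alpha * t)).

Lemma discount_ge0 t : 0 <= discount t. Proof. exact: expR_ge0. Qed.

Lemma discountD a b : discount (a + b) = discount a * discount b.
Proof. by rewrite -expRD /discount; congr expR; ring. Qed.

Lemma discount_continuous : continuous discount.
Proof.
move=> t; apply: (@continuous_comp R R R (fun t => - (alpha * t)) expR).
  apply: (@continuousN R R^o R).
  by apply: (@continuousM R R (fun=> alpha) id); [exact: cst_continuous|].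
exact: continuous_expR.
Qed.

Lemma measurable_discount : measurable_fun [set: R] discount.
Proof. by apply: continuous_measurable_fun; exact: discount_continuous. Qed.

Lemma is_derive_discount k t :
  is_derive t 1 (fun t => k * discount t) (- (k * alpha * discount t)).
Proof.
have h : is_derive t 1 (- alpha \*: id : R^o -> R^o) (- alpha *: 1).
  exact: is_deriveZ.
have := is_deriveZ k (is_derive1_comp (is_derive_expR _) h).
have -> : k \*: (expR \o (- alpha \*: id)) = fun t => k * discount t.
  apply/funext => u; rewrite /discount /=; congr (_ * expR _).
  by rewrite /GRing.scale/= mulNr.
move=> /is_derive_eq; apply; rewrite /discount /=.
have -> : - alpha *: t = - (alpha * t) by exact: mulNr.
by rewrite /GRing.scale /=; ring.
Qed.

Lemma continuous_scale_discount k : continuous (fun t => k * discount t).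
Proof.
move=> t; apply: (@continuousM R R (fun=> k)); first exact: cst_continuous.
exact: discount_continuous.
Qed.

Lemma integral_discount_itvco a b : a <= b ->
  (\int[mu]_(t in `[a, b[) (discount t)%:E)%E =
  ((discount a - discount b) / alpha)%:E.
Proof.
rewrite le_eqVlt => /predU1P[->|ab].
  by rewrite set_itvco0 integral_set0 subrr mul0r.
rewrite integral_itv_bndo_bndc; last first.
  by apply/measurable_EFinP; apply: measurable_funTS; exact: measurable_discount.
rewrite (@continuous_FTC2 R _ (fun t => - alpha^-1 * discount t))//.
- by rewrite -EFinB; congr EFin; field; rewrite gt_eqF.
- by apply: continuous_subspaceT; exact: discount_continuous.
- split.
  + by move=> t _; have := is_derive_discount (- alpha^-1) t => h; exact: ex_derive.
  + by apply: cvg_at_right_filter; exact: continuous_scale_discount.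
  + by apply: cvg_at_left_filter; exact: continuous_scale_discount.
- move=> t _; rewrite derive1E.
  have h := is_derive_discount (- alpha^-1) t; rewrite derive_val.
  by field; rewrite gt_eqF.
Qed.

Lemma integral_discount_tail a :
  (\int[mu]_(t in `[a, +oo[) (alpha * discount t)%:E)%E = (discount a)%:E.
Proof.
rewrite (@ge0_continuous_FTC2y R _ (fun t => -1 * discount t) a (-1 * 0)).
- by rewrite -EFinB; congr EFin; ring.
- by move=> t _; rewrite mulr_ge0 ?(ltW alpha_gt0)// discount_ge0.
- by apply: continuous_subspaceT; exact: continuous_scale_discount.
- apply: cvgM; first exact: cvg_cst.
  rewrite (_ : discount = (fun z => expR (- z)) \o (fun z => alpha * z))//.
  apply: (@cvg_comp _ _ _ _ _ _ (pinfty_nbhs R)); last exact: cvgr_expR.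
  exact: gt0_cvgMry.
- by move=> t _; have h := is_derive_discount (-1) t; exact: ex_derive.
- by apply: cvg_at_right_filter; exact: continuous_scale_discount.
- move=> t _; rewrite derive1E.
  have h := is_derive_discount (-1) t; rewrite derive_val.
  by ring.
Qed.

End exponential.

Section layer_cake.
Context (R : realType) d (T : measurableType d).
Variables (P : probability T R) (alpha : R).
Hypothesis alpha_gt0 : 0 < alpha.
Local Notation mu := (@lebesgue_measure R).
Local Notation disc := (discount alpha).

(* Writing e^{-alpha tau} as the integral of alpha e^{-alpha s} over s >= tau
   reduces discounted expectations to the distribution function of tau, which
   is what [game_law] prescribes. *)
Lemma layer_cake (D : set T) (tau f : T -> R) : measurable D ->
  measurable_fun [set: T] tau -> measurable_fun [set: T] f ->
  (forall w, 0 <= tau w) -> (forall w, 0 <= f w) ->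
  (\int[P]_(w in D) (f w * disc (tau w))%:E =
  \int[mu]_(s in `[0%R, +oo[) ((alpha * disc s)%:E *
    \int[P]_(w in D `&` [set w | (tau w <= s)%R]) (f w)%:E))%E.
Proof.
move=> mD mtau mf tau0 f0.
pose graph := [set z : T * R | tau z.1 <= z.2].
have mgraph : measurable graph.
  rewrite [graph](_ : _ = [set: T * R] `&` (fun z => tau z.1 <= z.2) @^-1` [set true]).
    have ml : measurable_fun [set: T * R] (fun z => tau z.1 <= z.2).
      by apply: measurable_fun_ler => //; exact: measurableT_comp.
    exact: ml.
  by rewrite setTI; apply/seteqP; split => z /=.
have ad0 s : 0 <= alpha * disc s by rewrite mulr_ge0 ?(ltW alpha_gt0)// discount_ge0.
pose g (z : T * R) : R := f z.1 * \1_D z.1 *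
  (alpha * disc z.2 * \1_(`[0, +oo[%classic : set R) z.2) * \1_graph z.
have g0 z : (0 <= (EFin \o g) z)%E by rewrite lee_fin mulr_ge0// mulr_ge0// mulr_ge0.
have mdisc : measurable_fun [set: R] disc by exact: measurable_discount.
have mg : measurable_fun [set: T * R] (EFin \o g).
  apply/measurable_EFinP; apply: measurable_funM; last exact: measurable_indic.
  apply: measurable_funM.
    apply: measurable_funM; first exact: measurableT_comp.
    have mD1 : measurable_fun [set: T] (\1_D : T -> R) by exact: measurable_indic.
    exact: (measurableT_comp mD1 measurable_fst).
  apply: measurable_funM.
    apply: measurable_funM; first exact: measurable_cst.
    exact: measurableT_comp.
  have m0 : measurable_fun [set: R] (\1_(`[0, +oo[%classic : set R) : R -> R).
    by apply: measurable_indic.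
  exact: (measurableT_comp m0 measurable_snd).
(* Integrating [g] over s first gives the left-hand side, over w first the right-hand side. *)
have := fubini_tonelli (m1 := P) (m2 := mu) (EFin \o g) mg g0.
congr (_ = _).
- rewrite [RHS]integral_mkcond; apply: eq_integral => w _.
  rewrite patchE; case: ifPn => wD; last first.
    rewrite integral0_eq// => s _ /=; rewrite /g /= indicE (negbTE wD).
    by rewrite mulr0 !mul0r.
  transitivity (\int[mu]_(s in `[tau w, +oo[) ((f w)%:E * (alpha * disc s)%:E))%E.
    rewrite [RHS]integral_mkcond; apply: eq_integral => s _.
    rewrite patchE /= /g /= !indicE wD mulr1 /graph.
    have -> : (s \in [set` `[tau w, +oo[]) = (tau w <= s).
      by apply/idP/idP; rewrite inE /= in_itv/= andbT.
    have -> : ((w, s) \in [set z | tau z.1 <= z.2]) = (tau w <= s).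
      by apply/idP/idP; rewrite inE.
    case: ifPn => ws; last by rewrite mulr0.
    by rewrite mem_set /= ?in_itv/= ?andbT ?(le_trans (tau0 w))// !mulr1.
  rewrite ge0_integralZl_EFin//; last 2 first.
    by move=> s _; rewrite lee_fin.
    apply/measurable_EFinP; apply: measurable_funM; first exact: measurable_cst.
    exact: measurable_funTS.
  by rewrite integral_discount_tail// -EFinM.
- rewrite [RHS]integral_mkcond; apply: eq_integral => s _.
  rewrite patchE; case: ifPn => s0; last first.
    rewrite integral0_eq// => w _ /=; rewrite /g /= !indicE (negbTE s0).
    by rewrite !mulr0 mul0r.
  rewrite [in RHS]integral_mkcond -ge0_integralZl_EFin//; last 2 first.
    by move=> w _; rewrite erestrict_ge0// => ? _; rewrite lee_fin.
    apply/(measurable_restrictT _ _).1 => //.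
      apply: measurableI => //; rewrite -[X in measurable X]setTI.
      have ml : measurable_fun [set: T] (fun w => tau w <= s).
        exact: measurable_fun_ler.
      have := ml measurableT [set true]; rewrite (_ : _ @^-1` _ = [set w | tau w <= s]).
        exact.
      by apply/seteqP; split => w /=.
    by apply/measurable_EFinP; exact: measurable_funTS.
  apply: eq_integral => w _; rewrite patchE /= /g /= !indicE s0 mulr1.
  case: ifPn => [|wD].
    rewrite inE => -[wD ws]; rewrite !mem_set//= !mulr1 -EFinM.
    by congr EFin; ring.
  rewrite mule0; congr EFin; apply/eqP; rewrite mulf_eq0 mulf_eq0 mulf_eq0.
  have [wD'|_] := boolP (w \in D); last by rewrite eqxx !orbT.
  rewrite [_ \in graph]memNset ?eqxx ?orbT// => gws.
  by move/negP: wD; apply; rewrite inE; split => //; rewrite -inE.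
Qed.

Lemma integral_partition (I : finType) (cell : T -> I) (D : set T)
    (f : T -> \bar R) :
  measurable D -> (forall x, measurable (cell @^-1` [set x])) ->
  measurable_fun D f -> (forall w, 0 <= f w)%E ->
  (\int[P]_(w in D) f w =
   \sum_x \int[P]_(w in D `&` cell @^-1` [set x]) f w)%E.
Proof.
move=> mD mcell mf f0.
have DE : D = \big[setU/set0]_x (D `&` cell @^-1` [set x]).
  apply/seteqP; split=> w.
    move=> Dw; rewrite -bigcup_seq; exists (cell w) => //=.
    exact: mem_index_enum.
  by rewrite -bigcup_seq => -[x _ []].
rewrite {1}DE ge0_integral_bigsetU//.
- by move=> x; exact: measurableI.
- exact: index_enum_uniq.
- by move=> x y _ _ [w [[_ /= <-] [_ /= <-]]].
- by rewrite -DE.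
Qed.

End layer_cake.

(** * Discounted payoff along a path *)

Section paths.
Variables (R : realType) (K S A B : finPointedType).
Implicit Types (w : path_space R K S A B) (r : K -> S -> A -> B -> R).
Local Notation mu := (@lebesgue_measure R).

Lemma sojourn_ge0 n w : 0 <= sojourn n w.
Proof. by rewrite /sojourn. Qed.

Lemma jump_time0 w : jump_time 0 w = 0.
Proof. by rewrite /jump_time big_ord0. Qed.

Lemma jump_timeS n w : jump_time n.+1 w = jump_time n w + sojourn n w.
Proof. by rewrite /jump_time big_ord_recr. Qed.

Lemma jump_time_nondecreasing w : nondecreasing_seq (fun n => jump_time n w).
Proof.
by apply/nondecreasing_seqP => n; rewrite jump_timeS lerDl sojourn_ge0.
Qed.

Lemma jump_time_ge0 n w : 0 <= jump_time n w.
Proof. by rewrite -(jump_time0 w); exact: jump_time_nondecreasing. Qed.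

(** Half-open, hence empty for a sojourn of length zero; the intervals stay disjoint even when
    several jumps coincide. *)
Definition sojourn_interval w n : set R :=
  `[jump_time n w, jump_time n.+1 w[%classic.

Lemma sojourn_interval_unique w t m n :
  sojourn_interval w m t -> sojourn_interval w n t -> m = n.
Proof.
rewrite /sojourn_interval /= !in_itv /= => /andP[mt tm] /andP[nt tn].
have h k l : jump_time k w <= t -> t < jump_time l.+1 w -> (k <= l)%N.
  move=> kt tl; rewrite leqNgt; apply/negP => lk.
  have /= := jump_time_nondecreasing w lk.
  by rewrite leNgt (le_lt_trans kt tl).
by apply/eqP; rewrite eqn_leq !h.
Qed.

Lemma epoch_sojourn w t n : sojourn_interval w n t -> epoch w t = n.
Proof.
move=> nt; apply: xget_unique => [|m mt].
  by move: nt; rewrite /sojourn_interval /= in_itv.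
by apply: (@sojourn_interval_unique w t) => //; rewrite /sojourn_interval /= in_itv.
Qed.

(** The explosion time is the supremum of the jump times; the interval containing t is found from
    the least n with t < T_n, and n > 0 because T_0 = 0. *)
Lemma lifetime_bigcup w :
  [set t : R | 0 <= t /\ (t%:E < explosion_time w)%E] =
  \bigcup_n sojourn_interval w n.
Proof.
have nd : nondecreasing_seq (fun n => (jump_time n w)%:E).
  by move=> m n mn; rewrite lee_fin jump_time_nondecreasing.
have expE : explosion_time w = ereal_sup (range (fun n => (jump_time n w)%:E)).
  by apply/cvg_lim => //; exact: ereal_nondecreasing_cvgn.
apply/seteqP; split=> t.
  move=> [t0]; rewrite expE => /ereal_sup_gt[_ [n _ <-]]; rewrite lte_fin => tn.
  have ex : exists n, t < jump_time n w by exists n.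
  case: (ex_minnP ex) => -[|m] tm mmin; first by rewrite jump_time0 ltNge t0 in tm.
  exists m => //; rewrite /sojourn_interval /= in_itv/= tm andbT leNgt.
  by apply/negP => /mmin; rewrite ltnn.
move=> [n _]; rewrite /sojourn_interval /= in_itv/= => /andP[nt tn].
split; first exact: le_trans (jump_time_ge0 n w) nt.
apply: (@lt_le_trans _ _ (jump_time n.+1 w)%:E); first by rewrite lte_fin.
by rewrite expE; apply: ereal_sup_ubound; exists n.+1.
Qed.

Variable alpha : R.
Hypothesis alpha_gt0 : 0 < alpha.
Local Notation disc := (discount alpha).

(** The integral of e^{-alpha t} r over the n-th sojourn, in closed form. *)
Definition stage_reward r n w : R :=
  r (game_type w) (state n w) (act1 n w) (act2 n w) *
  ((disc (jump_time n w) - disc (jump_time n.+1 w)) / alpha).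

Lemma stage_reward_ge0 r n w : (forall k s a b, 0 <= r k s a b) ->
  0 <= stage_reward r n w.
Proof.
move=> r0; rewrite mulr_ge0// divr_ge0 ?(ltW alpha_gt0)// subr_ge0.
by rewrite ler_expR lerN2 ler_pM2l// jump_time_nondecreasing.
Qed.

(** Nonnegativity of [r] allows the integral to be split over countably many sojourns without an
    integrability check. *)
Lemma discounted_series r w : (forall k s a b, 0 <= r k s a b) ->
  discounted alpha r w = (\sum_(n <oo) (stage_reward r n w)%:E)%E.
Proof.
move=> r0; rewrite /discounted lifetime_bigcup.
pose rn n := r (game_type w) (state n w) (act1 n w) (act2 n w).
set f := (X in integral _ _ X).
have fE n t : sojourn_interval w n t -> f t = ((rn n)%:E * (disc t)%:E)%E.
  move=> nt; rewrite /f /state_at /act1_at /act2_at (epoch_sojourn nt) -EFinM.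
  by rewrite mulrC.
have mdisc (D : set R) : measurable_fun D (EFin \o disc).
  by apply/measurable_EFinP; apply: measurable_funTS; exact: measurable_discount.
have intE n : (\int[mu]_(t in sojourn_interval w n) f t = (stage_reward r n w)%:E)%E.
  transitivity (\int[mu]_(t in sojourn_interval w n) ((rn n)%:E * (disc t)%:E))%E.
    by apply: eq_integral => t; rewrite inE; exact: fE.
  rewrite ge0_integralZl_EFin//.
  + by rewrite integral_discount_itvco// jump_time_nondecreasing.
  + exact: measurable_itv.
  + by move=> t _; rewrite lee_fin discount_ge0.
  + exact: mdisc.
  + exact: r0.
rewrite ge0_integral_bigcup//.
- by apply: eq_eseriesr => n _; exact: intE.
- by move=> n; exact: measurable_itv.
- apply/measurable_fun_bigcup => n.
    exact: measurable_itv.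
  apply: (@eq_measurable_fun _ _ _ _ _ (fun t => (rn n)%:E * (disc t)%:E)%E).
    by move=> t; rewrite inE => nt; exact: (esym (fE _ _ nt)).
  by apply: emeasurable_funM => //; exact: measurable_cst.
- by move=> t _; rewrite lee_fin mulr_ge0// expR_ge0.
- move=> m n _ _ [t [mt nt]]; exact: sojourn_interval_unique mt nt.
Qed.

(** The dual rates c - z may change sign. As e^{-alpha t} is nonnegative, the positive and negative
    parts of the integrand are the discounted parts of the rate. *)
Lemma discounted_posneg r w : discounted alpha r w =
  (discounted alpha (fun k s a b => Num.max (r k s a b) 0%R) w -
   discounted alpha (fun k s a b => Num.max (- r k s a b)%R 0%R) w)%E.
Proof.
rewrite /discounted integralE; congr (_ - _)%E; apply: eq_integral => t _.
  rewrite funeposE -EFin_max; congr EFin.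
  by rewrite -[X in Num.max _ X](mulr0 (expR (- (alpha * t)))) maxr_pMr ?expR_ge0.
rewrite funenegE -EFinN -EFin_max; congr EFin.
by rewrite -[X in Num.max _ X](mulr0 (expR (- (alpha * t)))) -mulrN maxr_pMr ?expR_ge0.
Qed.

End paths.

(** * Laplace transform of the semi-Markov kernel *)

Section kernel_transform.
Variables (R : realType) (S A B : finType).
Variables (Q : R -> S -> S -> A -> B -> R) (hQ : semi_markov_kernel Q).
Variable alpha : R.
Hypothesis alpha_gt0 : 0 < alpha.
Local Notation mu := (@lebesgue_measure R).
Local Notation disc := (discount alpha).

(* The Laplace-Stieltjes transform int_0^oo e^{-alpha t} Q(dt,j|x,a,b), after
   an integration by parts; Num.max 0 discards the junk values of Q at t < 0. *)
Definition laplace_density x a b j (t : R) : R :=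
  alpha * disc t * Q (Num.max 0 t) j x a b.

Definition laplace x a b j : R :=
  fine (\int[mu]_(t in `[0%R, +oo[) (laplace_density x a b j t)%:E)%E.

Let maxr0_ge0 (t : R) : 0 <= Num.max 0 t. Proof. by rewrite le_max lexx. Qed.

Lemma laplace_density_ge0 x a b j t : 0 <= laplace_density x a b j t.
Proof.
by rewrite !mulr_ge0 ?(ltW alpha_gt0) ?discount_ge0//; exact: (smk_ge0 hQ).
Qed.

Lemma measurable_kernel x a b j :
  measurable_fun [set: R] (fun t => Q (Num.max 0 t) j x a b).
Proof.
apply: nondecreasing_measurable => // s t st.
apply: (smk_nondecreasing hQ) => //.
by rewrite ge_max maxr0_ge0 /= le_max st orbT.
Qed.

Lemma measurable_laplace_density x a b j :
  measurable_fun [set: R] (laplace_density x a b j).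
Proof.
apply: measurable_funM; last exact: measurable_kernel.
by apply: measurable_funM => //; exact: measurable_discount.
Qed.

Lemma kernel_le1 x a b j t : 0 <= t -> Q t j x a b <= 1.
Proof.
move=> t0; apply: le_trans (smk_sum_le1 hQ x a b t0).
by rewrite (bigD1 j)//= lerDl sumr_ge0// => k _; exact: (smk_ge0 hQ).
Qed.

(** As Q <= 1, the integral is at most that of alpha e^{-alpha t}, which is 1, so [fine] loses
    nothing. *)
Lemma laplaceE x a b j : ((laplace x a b j)%:E =
  \int[mu]_(t in `[0%R, +oo[) (laplace_density x a b j t)%:E)%E.
Proof.
rewrite fineK// ge0_fin_numE; last first.
  by apply: integral_ge0 => t _; rewrite lee_fin laplace_density_ge0.
apply: (@le_lt_trans _ _ (\int[mu]_(t in `[0%R, +oo[) (alpha * disc t)%:E)%E).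
  apply: ge0_le_integral => //.
  - by move=> t _; rewrite lee_fin laplace_density_ge0.
  - by apply/measurable_EFinP; apply: measurable_funTS; exact: measurable_laplace_density.
  - by apply/measurable_EFinP; apply: measurable_funTS;
      apply: measurable_funM => //; exact: measurable_discount.
  - move=> t _; rewrite lee_fin ler_piMr ?kernel_le1//.
    by rewrite mulr_ge0 ?(ltW alpha_gt0) ?discount_ge0.
by rewrite integral_discount_tail// ltry.
Qed.

Lemma laplace_ge0 x a b j : 0 <= laplace x a b j.
Proof.
rewrite -lee_fin laplaceE; apply: integral_ge0 => t _.
by rewrite lee_fin laplace_density_ge0.
Qed.

(** On [0,delta) monotonicity bounds D by 1 - eps, afterwards D <= 1; integrating 1 - eps + eps 1_{t
    >= delta} against alpha e^{-alpha t} gives the bound. *)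
Lemma laplace_sum_le (delta eps : R) : 0 < delta -> 0 < eps < 1 ->
  (forall x a b, sojourn_cdf Q delta x a b <= 1 - eps) ->
  forall x a b, \sum_j laplace x a b j <= 1 - eps + eps * disc delta.
Proof.
move=> d0 /andP[e0 e1] hD x a b.
have ad0 t : 0 <= alpha * disc t by rewrite mulr_ge0 ?(ltW alpha_gt0) ?discount_ge0.
have mad : measurable_fun [set: R] (fun t => alpha * disc t).
  by apply: measurable_funM => //; exact: measurable_discount.
have e1' : 0 <= 1 - eps by rewrite subr_ge0 ltW.
rewrite -lee_fin -sumEFin; under eq_bigr do rewrite laplaceE.
rewrite -ge0_integral_sum//; last 2 first.
- move=> j; apply/measurable_EFinP; apply: measurable_funTS.
  exact: measurable_laplace_density.
- by move=> j t _; rewrite lee_fin laplace_density_ge0.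
pose g t : \bar R := ((1 - eps)%:E * (alpha * disc t)%:E +
  eps%:E * ((fun t => (alpha * disc t)%:E) \_ `[delta, +oo[) t)%E.
have mg1 : measurable_fun [set: R] (fun t => (1 - eps)%:E * (alpha * disc t)%:E)%E.
  by apply: measurable_funeM; exact/measurable_EFinP.
have mg2' : measurable_fun [set: R]
    ((fun t => (alpha * disc t)%:E) \_ `[delta, +oo[ : R -> \bar R).
  apply/(measurable_restrictT _ _).1 => //.
  by apply/measurable_EFinP; exact: measurable_funTS.
have mg2 : measurable_fun [set: R]
    (fun t => eps%:E * ((fun t => (alpha * disc t)%:E) \_ `[delta, +oo[) t)%E.
  exact: measurable_funeM.
have g2' t : (0 <= ((fun t => (alpha * disc t)%:E) \_ `[delta, +oo[) t)%E.
  by apply: erestrict_ge0 => ? _; rewrite lee_fin.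
apply: (@le_trans _ _ (\int[mu]_(t in `[0%R, +oo[) g t)%E).
  apply: ge0_le_integral => //.
  - by move=> t _; apply: sume_ge0 => j _; rewrite lee_fin laplace_density_ge0.
  - apply: measurable_funTS; apply: emeasurable_sum => j.
    by apply/measurable_EFinP; exact: measurable_laplace_density.
  - by apply: measurable_funTS; exact: emeasurable_funD.
  - move=> t; rewrite /= in_itv/= andbT => t0; rewrite sumEFin /g patchE.
    rewrite -mulr_sumr (max_r t0).
    case: ifPn => td.
      rewrite -!EFinM -EFinD lee_fin.
      have := smk_sum_le1 hQ x a b t0; have := ad0 t; nra.
    rewrite mule0 adde0 -EFinM lee_fin [leRHS]mulrC ler_wpM2l//.
    apply: le_trans (hD x a b); apply: ler_sum => j _.
    apply: (smk_nondecreasing hQ) => //; rewrite leNgt; apply/negP => dt.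
    by move/negP: td; apply; rewrite inE /= in_itv/= andbT ltW.
rewrite ge0_integralD//; last 4 first.
- by move=> t _; rewrite mule_ge0 ?lee_fin.
- exact: measurable_funTS.
- by move=> t _; rewrite mule_ge0 ?lee_fin// ltW.
- exact: measurable_funTS.
rewrite ge0_integralZl_EFin//; last 2 first.
- by move=> t _; rewrite lee_fin.
- by apply/measurable_EFinP; exact: measurable_funTS.
rewrite integral_discount_tail// ge0_integralZl_EFin//; last 2 first.
- exact: measurable_funTS.
- exact: ltW.
rewrite -integral_mkcondr (_ : _ `&` _ = `[delta, +oo[%classic); last first.
  apply/seteqP; split=> t /=; rewrite !in_itv/= !andbT; first by case.
  by move=> dt; split=> //; exact: le_trans (ltW d0) dt.
rewrite integral_discount_tail// -!EFinM -EFinD lee_fin.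
by rewrite /discount mulr0 oppr0 expR0 mulr1.
Qed.

End kernel_transform.

(** * Expected discounted payoff *)

Section measurability.
Variables (R : realType) (K S A B : finPointedType).
Local Notation Om := (Omega R K S A B).

Lemma measurable_cylinder (E : set Om) : cylinders E -> measurable E.
Proof. exact: sub_sigma_algebra. Qed.

Lemma measurable_game_type k : measurable [set w : Om | game_type w = k].
Proof. by apply: measurable_cylinder; left; exists k. Qed.

Lemma measurable_state n x : measurable [set w : Om | state n w = x].
Proof. by apply: measurable_cylinder; right; left; exists n, x. Qed.

Lemma measurable_act1 n a : measurable [set w : Om | act1 n w = a].
Proof. by apply: measurable_cylinder; right; right; left; exists n, a. Qed.

Lemma measurable_act2 n b : measurable [set w : Om | act2 n w = b].
Proof. by apply: measurable_cylinder; right; right; right; left; exists n, b. Qed.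

Lemma measurable_sojourn n : measurable_fun [set: Om] (fun w : Om => sojourn n w).
Proof.
move=> _ Y mY; rewrite setTI; apply: measurable_cylinder.
by right; right; right; right; exists n, Y.
Qed.

Lemma measurable_jump_time n : measurable_fun [set: Om] (fun w : Om => jump_time n w).
Proof. by apply: measurable_sum => m; exact: measurable_sojourn. Qed.

Lemma hist_extend n (w : Om) :
  hist n.+1 w = extend (hist n w) (act1 n w) (act2 n w) (state n.+1 w).
Proof.
rewrite /hist /extend; congr pair; apply: tuple_rconsP => [m|].
  by rewrite !tnth_mktuple.
by rewrite tnth_mktuple.
Qed.

Lemma hist_extendP n (w : Om) (h : n.+1.-tuple (S * A * B) * S) :
  hist n.+1 w = h <-> [/\ hist n w = init_hist h, act1 n w = (last_step h).1.2,
    act2 n w = (last_step h).2 & state n.+1 w = h.2].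
Proof.
rewrite hist_extend; split=> [<-|[-> -> -> ->]]; last exact: extend_init_hist.
by rewrite init_hist_extend last_step_extend.
Qed.

Lemma measurable_hist n (h : history S A B n) :
  measurable [set w : Om | hist n w = h].
Proof.
elim: n h => [|n IH] h.
  rewrite (_ : [set _ | _] = [set w : Om | state 0 w = h.2]).
    exact: measurable_state.
  apply/seteqP; split=> w /=; first by move=> <-.
  by case: h => l x /= <-; rewrite /hist (tuple0 l); congr pair; exact: tuple0.
rewrite (_ : [set _ | _] = [set w : Om | hist n w = init_hist h] `&`
  ([set w : Om | act1 n w = (last_step h).1.2] `&`
  ([set w : Om | act2 n w = (last_step h).2] `&`
   [set w : Om | state n.+1 w = h.2]))).
  apply: measurableI; first exact: IH.
  apply: measurableI; first exact: measurable_act1.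
  apply: measurableI; first exact: measurable_act2.
  exact: measurable_state.
apply/seteqP; split=> w /=; first by move=> /hist_extendP[].
by move=> [? [? [? ?]]]; apply/hist_extendP.
Qed.

(** On [past_event] the action probabilities prescribed by [game_law] are constant in w, and on
    [act_event] the jump probabilities are, so conditioning reduces to multiplication by a
    number. *)
Definition past_event n k (h : history S A B n) : set Om :=
  [set w | game_type w = k /\ hist n w = h].

Definition act_event n k (h : history S A B n) a b : set Om :=
  [set w | [/\ game_type w = k, hist n w = h, act1 n w = a & act2 n w = b]].

Definition next_event n k (h : history S A B n) a b j : set Om :=
  [set w | act_event k h a b w /\ state n.+1 w = j].

Lemma measurable_past_event n k (h : history S A B n) : measurable (past_event k h).
Proof.
by apply: measurableI; [exact: measurable_game_type|exact: measurable_hist].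
Qed.

Lemma measurable_act_event n k (h : history S A B n) a b :
  measurable (act_event k h a b).
Proof.
rewrite (_ : act_event _ _ _ _ = past_event k h `&`
  ([set w : Om | act1 n w = a] `&` [set w : Om | act2 n w = b])); last first.
  by apply/seteqP; split=> w /=; [case|move=> [[? ?] [? ?]]].
apply: measurableI; first exact: measurable_past_event.
by apply: measurableI; [exact: measurable_act1|exact: measurable_act2].
Qed.

Lemma measurable_next_event n k (h : history S A B n) a b j :
  measurable (next_event k h a b j).
Proof.
by apply: measurableI; [exact: measurable_act_event|exact: measurable_state].
Qed.

End measurability.

(** * From distribution functions to discounted integrals *)

Section proportional.
Context (R : realType) d (T : measurableType d).
Variables (P : probability T R) (alpha : R).
Hypothesis alpha_gt0 : 0 < alpha.
Local Notation disc := (discount alpha).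

Lemma measurable_le (tau : T -> R) s : measurable_fun [set: T] tau ->
  measurable [set w | tau w <= s].
Proof.
move=> mtau; have := mtau measurableT `]-oo, s]%classic (measurable_itv _).
by rewrite setTI; congr measurable; apply/seteqP; split => w /=; rewrite in_itv.
Qed.

Lemma measurable_disc (D : set T) (tau : T -> R) : measurable_fun [set: T] tau ->
  measurable_fun D (fun w => (disc (tau w))%:E).
Proof.
move=> mtau; apply/measurable_EFinP; apply: measurable_funTS.
exact: (measurableT_comp (measurable_discount alpha) mtau).
Qed.

(** By [layer_cake] the discounted integral over [D] depends on [tau] only through P(D, tau <= s)
    for s >= 0, so a factor common to all s carries over. *)
Lemma discount_integral_proportional (D D' : set T) (tau : T -> R) (c : R) :
  measurable D -> measurable D' -> measurable_fun [set: T] tau ->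
  (forall w, 0 <= tau w) -> 0 <= c ->
  (forall s, 0 <= s -> P (D `&` [set w | tau w <= s]) =
    (c%:E * P (D' `&` [set w | (tau w <= s)%R]))%E) ->
  (\int[P]_(w in D) (disc (tau w))%:E = c%:E * \int[P]_(w in D') (disc (tau w))%:E)%E.
Proof.
move=> mD mD' mtau tau0 c0 PD.
rewrite -ge0_integralZl_EFin//; last 2 first.
- by move=> w _; rewrite lee_fin discount_ge0.
- exact: measurable_disc.
transitivity (\int[P]_(w in D) (1 * disc (tau w))%:E)%E.
  by apply: eq_integral => w _; rewrite mul1r.
transitivity (\int[P]_(w in D') (c * disc (tau w))%:E)%E; last first.
  by apply: eq_integral => w _; rewrite EFinM.
rewrite (layer_cake P alpha_gt0 (f := fun=> 1) mD mtau (measurable_cst _) tau0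
  (fun=> ler01)).
rewrite (layer_cake P alpha_gt0 (f := fun=> c) mD' mtau (measurable_cst _) tau0
  (fun=> c0)).
apply: eq_integral => s; rewrite inE /= in_itv/= andbT => s0.
have ms := measurable_le s mtau.
rewrite (integral_cst P (measurableI _ _ mD ms)).
rewrite (integral_cst P (measurableI _ _ mD' ms)) mul1e.
by congr (_ * _)%E; exact: PD.
Qed.

End proportional.

(** * Discounted masses under the law of the game *)

Section law.
Variables (R : realType) (K S A B : finPointedType).
Variables (Q : R -> S -> S -> A -> B -> R) (hQ : semi_markov_kernel Q).
Variable alpha : R.
Hypothesis alpha_gt0 : 0 < alpha.
Variables (p : dist R K) (i : S) (pi : policy1 R K S A B) (sg : policy2 R S A B).
Variable P : probability (Omega R K S A B) R.
Hypothesis lawP : game_law Q p i pi sg P.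
Local Notation Om := (Omega R K S A B).
Local Notation disc := (discount alpha).
Local Notation beta := (laplace Q alpha).

Lemma measurable_disc_jump n (D : set Om) :
  measurable_fun D (fun w : Om => (disc (jump_time n w))%:E).
Proof. by apply: measurable_disc; exact: measurable_jump_time. Qed.

(** The generators of the past include half-lines for T_n, so [past_event] cut at T_n <= s is an
    event on which the conditional probability may be integrated. *)
Lemma law_act_event n k (h : history S A B n) a b s : P (act_event k h a b `&`
    [set w | jump_time n w <= s]) = ((pi k h a * sg h b)%:E *
   P (past_event k h `&` [set w | (jump_time n w <= s)%R]))%E.
Proof.
have [_ actP] := law_act lawP n a b.
rewrite (_ : _ `&` _ = (past_event k h `&` [set w | jump_time n w <= s]) `&`
    [set w | act1 n w = a /\ act2 n w = b]); last first.
  apply/seteqP; rewrite /act_event /past_event; split => w /=.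
    by move=> [[? ? ? ?] ?].
  by move=> [[[? ?] ?] [? ?]].
rewrite actP; last first.
  apply: sub_sigma_algebra; exists k, h, `]-oo, s]%classic; split.
    exact: measurable_itv.
  by apply/seteqP; rewrite ?/next_event ?/act_event ?/past_event;
    split=> w /=; rewrite in_itv /=;
    [move=> [[? ?] ?]|move=> [? [? ?]]].
transitivity (\int[P]_(w in past_event k h `&` [set w | (jump_time n w <= s)%R])
    (cst (pi k h a * sg h b)%:E) w)%E.
  by apply: eq_integral => w; rewrite inE /= => -[[-> ->] _].
rewrite integral_cst//; apply: measurableI; first exact: measurable_past_event.
by apply: measurable_le; exact: measurable_jump_time.
Qed.

Lemma law_next_event n k (h : history S A B n) a b j s t : 0 <= t ->
  P (next_event k h a b j `&` [set w | sojourn n w <= t] `&`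
      [set w | jump_time n w <= s]) =
  ((Q t j h.2 a b)%:E *
   P (act_event k h a b `&` [set w | (jump_time n w <= s)%R]))%E.
Proof.
move=> t0.
have [_ jumpP] := law_jump lawP n j t0.
rewrite (_ : _ `&` _ = (act_event k h a b `&` [set w | jump_time n w <= s]) `&`
    [set w | jump_time n.+1 w - jump_time n w <= t /\ state n.+1 w = j]); last first.
  apply/seteqP; rewrite /next_event /act_event; split => w /=.
    by move=> [[[? ?] ?] ?]; rewrite jump_timeS addrAC subrr add0r.
  by rewrite jump_timeS addrAC subrr add0r => -[[? ?] [? ?]].
rewrite jumpP; last first.
  apply: sub_sigma_algebra; exists k, h, `]-oo, s]%classic, a, b; split.
    exact: measurable_itv.
  apply/seteqP; rewrite ?/next_event ?/act_event ?/past_event;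
    split=> w /=; rewrite in_itv /=.
    by move=> [[? ? ? ?] ?].
  by move=> [? [? [? [? ?]]]].
transitivity (\int[P]_(w in act_event k h a b `&` [set w | (jump_time n w <= s)%R])
    (cst (Q t j h.2 a b)%:E) w)%E.
  apply: eq_integral => w; rewrite inE /= => -[[_ hh -> ->] _].
  by rewrite -hh.
rewrite integral_cst//; apply: measurableI; first exact: measurable_act_event.
by apply: measurable_le; exact: measurable_jump_time.
Qed.

Lemma act_event_mass n k (h : history S A B n) a b :
  (\int[P]_(w in act_event k h a b) (disc (jump_time n w))%:E =
   (pi k h a * sg h b)%:E *
   \int[P]_(w in past_event k h) (disc (jump_time n w))%:E)%E.
Proof.
apply: discount_integral_proportional => //.
- exact: measurable_act_event.
- exact: measurable_past_event.
- exact: measurable_jump_time.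
- by move=> w; exact: jump_time_ge0.
- by rewrite mulr_ge0 ?dist_ge0.
- by move=> s _; exact: law_act_event.
Qed.

(** The discount at T_{n+1} factors into that at T_n and that of the sojourn. The layer cake for the
    sojourn leaves, for each t, the discount at T_n on sojourns of length at most t, which
    [law_next_event] turns into Q(t) times [G]; integrating over t produces [beta]. *)
Lemma next_event_mass n k (h : history S A B n) a b j G :
  (\int[P]_(w in act_event k h a b) (disc (jump_time n w))%:E = G%:E)%E ->
  (\int[P]_(w in next_event k h a b j) (disc (jump_time n.+1 w))%:E =
   (beta h.2 a b j * G)%:E)%E.
Proof.
move=> GE.
have G0 : (0 <= G%:E)%E.
  by rewrite -GE; apply: integral_ge0 => w _; rewrite lee_fin discount_ge0.
transitivity (\int[P]_(w in next_event k h a b j)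
    (disc (jump_time n w) * disc (sojourn n w))%:E)%E.
  by apply: eq_integral => w _; rewrite jump_timeS discountD.
rewrite (layer_cake P alpha_gt0 (f := fun w => disc (jump_time n w))); last 5 first.
- exact: measurable_next_event.
- exact: measurable_sojourn.
- by apply/measurable_EFinP; exact: measurable_disc_jump.
- by move=> w; exact: sojourn_ge0.
- by move=> w; exact: discount_ge0.
rewrite EFinM (laplaceE hQ alpha_gt0) -ge0_integralZr//; last 2 first.
- by apply/measurable_EFinP; apply: measurable_funTS; exact: measurable_laplace_density.
- by move=> t _; rewrite lee_fin laplace_density_ge0.
apply: eq_integral => t; rewrite inE /= in_itv/= andbT => t0.
rewrite /laplace_density (max_r t0) [in RHS]EFinM -muleA; congr (_ * _)%E.
rewrite -GE; apply: discount_integral_proportional => //.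
- apply: measurableI; first exact: measurable_next_event.
  by apply: measurable_le; exact: measurable_sojourn.
- exact: measurable_act_event.
- exact: measurable_jump_time.
- by move=> w; exact: jump_time_ge0.
- exact: (smk_ge0 hQ).
- by move=> s _; exact: law_next_event.
Qed.

Lemma law_state0 : P [set w | state 0 w = i] = 1%E.
Proof.
have mi : measurable ([set w | state 0 w = i] : set Om) by exact: measurable_state.
have PE (D : set Om) : measurable D -> P D = (\int[P]_(w in D) 1)%E.
  by move=> mD; rewrite -[LHS]mul1e; exact: (esym (integral_cst P mD 1%E)).
rewrite PE// (@integral_partition _ _ _ _ _ (fun w : Om => game_type w))//.
  transitivity (\sum_k (p k)%:E)%E; last by rewrite sumEFin dist_sum1.
  apply: eq_bigr => k _; rewrite -PE; first exact: (law_init lawP).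
  by apply: measurableI => //; exact: measurable_game_type.
by move=> k; exact: measurable_game_type.
Qed.

(** [law_init] fixes only the probabilities of starting in [i]; they sum to one over the types, so
    all other initial states are null. *)
Lemma law_start k (x : S) :
  P [set w | state 0 w = x /\ game_type w = k] = (p k * (x == i)%:R)%:E.
Proof.
have [->|xi] := eqVneq x i; first by rewrite mulr1 (law_init lawP).
rewrite mulr0; apply/eqP; rewrite eq_le measure_ge0 andbT.
have mi : measurable ([set w | state 0 w = i] : set Om) by exact: measurable_state.
apply: (@le_trans _ _ (P (~` [set w | state 0 w = i]))).
  apply: le_measure; rewrite ?inE.
  - by apply: measurableI; [exact: measurable_state|exact: measurable_game_type].
  - exact: measurableC.
  - by move=> w /= [-> _]; exact/eqP.
by rewrite probability_setC// law_state0 subee.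
Qed.

(** Induction on n, one step being [act_event_mass] for the actions followed by [next_event_mass]
    for the jump. *)
Lemma past_event_mass n k (h : history S A B n) :
  (\int[P]_(w in past_event k h) (disc (jump_time n w))%:E =
   (p k * history_mass i beta (pi k) sg h)%:E)%E.
Proof.
elim: n h => [|n IH] h.
  transitivity (\int[P]_(w in past_event k h) (cst 1 w))%E.
    apply: eq_integral => w _.
    by rewrite jump_time0 /discount mulr0 oppr0 expR0.
  rewrite integral_cst ?mul1e; last exact: measurable_past_event.
  rewrite /history_mass /= !mul1r -law_start; congr (P _).
  apply/seteqP; rewrite ?/next_event ?/act_event ?/past_event;
    split=> w /=; first by move=> [-> <-].
  case: h => l x /= [<- <-]; split => //.
  by rewrite /hist (tuple0 l); congr pair; exact: tuple0.
rewrite (_ : past_event k h = next_event k (init_hist h) (last_step h).1.2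
    (last_step h).2 h.2); last first.
  apply/seteqP; rewrite ?/next_event ?/act_event ?/past_event;
    split=> w /=; first by move=> [? /hist_extendP[]].
  by move=> [[? ? ? ?] ?]; split => //; apply/hist_extendP.
have := act_event_mass k (init_hist h) (last_step h).1.2 (last_step h).2.
rewrite IH -EFinM => /(next_event_mass h.2) ->.
by congr EFin; rewrite /history_mass /=; ring.
Qed.

Lemma occupation_mass n k (h : history S A B n) a b :
  (\int[P]_(w in act_event k h a b) (disc (jump_time n w))%:E =
   (p k * occupation i beta (pi k) sg h a b)%:E)%E.
Proof.
rewrite act_event_mass past_event_mass -EFinM; congr EFin.
by rewrite /occupation; ring.
Qed.

Lemma occupation_mass_next n k (h : history S A B n) a b :
  (\int[P]_(w in act_event k h a b) (disc (jump_time n.+1 w))%:E =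
   (p k * occupation i beta (pi k) sg h a b * \sum_j beta h.2 a b j)%:E)%E.
Proof.
rewrite (@integral_partition _ _ _ _ _ (fun w : Om => state n.+1 w)).
- rewrite mulr_sumr -sumEFin; apply: eq_bigr => j _.
  by rewrite (next_event_mass j (occupation_mass k h a b)); congr EFin; ring.
- exact: measurable_act_event.
- by move=> j; exact: measurable_state.
- exact: measurable_disc_jump.
- by move=> w; rewrite lee_fin discount_ge0.
Qed.

Lemma stage_reward_act_event (r : K -> S -> A -> B -> R) n k
    (h : history S A B n) a b : (forall k s a b, 0 <= r k s a b) ->
  (\int[P]_(w in act_event k h a b) (stage_reward alpha r n w)%:E =
   (p k * (occupation i beta (pi k) sg h a b *
     (sojourn_weight beta alpha h.2 a b * r k h.2 a b)))%:E)%E.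
Proof.
move=> r0; pose g (w : Om) : R := disc (jump_time n w) - disc (jump_time n.+1 w).
have g0 (w : Om) : 0 <= g w.
  by rewrite subr_ge0 ler_expR lerN2 ler_pM2l// jump_time_nondecreasing.
have mg (D : set Om) : measurable_fun D (fun w : Om => (g w)%:E).
  apply/measurable_EFinP; apply: measurable_funB; apply/measurable_EFinP;
    exact: measurable_disc_jump.
have mD := measurable_act_event (R := R) k h a b.
have gE : (\int[P]_(w in act_event k h a b) (g w)%:E =
    (p k * occupation i beta (pi k) sg h a b * (1 - \sum_j beta h.2 a b j))%:E)%E.
  (* The sum of the two integrals is computed first: its finite value then yields the difference
     without subtracting integrals. *)
  have : (\int[P]_(w in act_event k h a b) (g w)%:E +
      \int[P]_(w in act_event k h a b) (disc (jump_time n.+1 w))%:E =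
      (p k * occupation i beta (pi k) sg h a b)%:E)%E.
    rewrite -occupation_mass -ge0_integralD//.
    - by apply: eq_integral => w _; rewrite -EFinD subrK.
    - by move=> w _; rewrite lee_fin.
    - by move=> w _; rewrite lee_fin discount_ge0.
    - exact: measurable_disc_jump.
  rewrite occupation_mass_next; case: (\int[P]_(w in _) _)%E => [x| |] //=.
  by move=> [xE]; congr EFin; rewrite mulrBr mulr1 -[X in X - _]xE addrK.
transitivity (\int[P]_(w in act_event k h a b) ((r k h.2 a b / alpha)%:E * (g w)%:E))%E.
  apply: eq_integral => w; rewrite inE => -[kk hh aa bb]; rewrite -EFinM.
  by congr EFin; rewrite /stage_reward /g kk aa bb -hh /=; ring.
rewrite ge0_integralZl_EFin//.
- rewrite gE -EFinM; congr EFin; rewrite /sojourn_weight; ring.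
- by move=> w _; rewrite lee_fin.
- by rewrite divr_ge0// ltW.
Qed.

Lemma measurable_stage_reward (r : K -> S -> A -> B -> R) n :
  (forall k s a b, 0 <= r k s a b) ->
  measurable_fun [set: Om] (fun w : Om => (stage_reward alpha r n w)%:E).
Proof.
move=> r0; apply/measurable_EFinP; apply: measurable_funM; last first.
  apply: measurable_funM => //; apply: measurable_funB; apply/measurable_EFinP;
    exact: measurable_disc_jump.
(* Type, state and actions take finitely many values, so the rate is a finite combination of
   indicators. *)
rewrite (_ : (fun _ => _) = fun w : Om => \sum_(x : K * S * A * B)
    (r x.1.1.1 x.1.1.2 x.1.2 x.2 *
     \1_([set w : Om | game_type w = x.1.1.1] `&` ([set w | state n w = x.1.1.2] `&`
         ([set w | act1 n w = x.1.2] `&` [set w | act2 n w = x.2]))) w)).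
  apply: measurable_sum => x; apply: measurable_funM => //.
  apply: measurable_indic; apply: measurableI; first exact: measurable_game_type.
  apply: measurableI; first exact: measurable_state.
  by apply: measurableI; [exact: measurable_act1|exact: measurable_act2].
apply/funext => w.
rewrite (bigD1 (game_type w, state n w, act1 n w, act2 n w))//=.
rewrite indicE mem_set//= mulr1 big1 ?addr0// => -[[[k x] a] b] /= ne.
rewrite indicE memNset ?mulr0//= => -[e1 [e2 [e3 e4]]].
by move/eqP: ne; apply; rewrite e1 e2 e3 e4.
Qed.

Lemma expected_stage_reward (r : K -> S -> A -> B -> R) n :
  (forall k s a b, 0 <= r k s a b) ->
  (\int[P]_w (stage_reward alpha r n w)%:E =
   (\sum_k p k * stage_payoff i beta alpha (r k) (pi k) sg n)%:E)%E.
Proof.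
move=> r0.
rewrite (@integral_partition _ _ _ _ _ (fun w : Om =>
  (game_type w, (hist n w : n.-tuple (S * A * B) * S), act1 n w, act2 n w)));
  last 4 first.
- exact: measurableT.
- move=> [[[k h] a] b]; rewrite (_ : _ @^-1` _ = act_event k h a b).
    exact: measurable_act_event.
  by apply/seteqP; rewrite ?/next_event ?/act_event ?/past_event;
    split=> w /= [-> -> -> ->].
- exact: measurable_stage_reward.
- by move=> w; rewrite lee_fin stage_reward_ge0.
rewrite [RHS](_ : _ = (\sum_(x : K * (n.-tuple (S * A * B) * S) * A * B)
   p x.1.1.1 * (occupation i beta (pi x.1.1.1) sg x.1.1.2 x.1.2 x.2 *
     (sojourn_weight beta alpha x.1.1.2.2 x.1.2 x.2 *
      r x.1.1.1 x.1.1.2.2 x.1.2 x.2)))%:E); last first.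
  congr EFin.
  transitivity (\sum_k \sum_(h : n.-tuple (S * A * B) * S) \sum_a \sum_b
   p k * (occupation i beta (pi k) sg h a b *
     (sojourn_weight beta alpha h.2 a b * r k h.2 a b))).
    apply: eq_bigr => k _; rewrite /stage_payoff mulr_sumr.
    by do 2!(apply: eq_bigr => ? _; rewrite mulr_sumr).
  by rewrite !pair_bigA.
rewrite -sumEFin; apply: eq_bigr => -[[[k h] a] b] _ /=.
rewrite -stage_reward_act_event//; congr (integral _ _ _).
by apply/seteqP; rewrite ?/next_event ?/act_event ?/past_event;
    split=> w /=;
  [move=> [_ [-> -> -> ->]]|move=> [-> -> -> ->]].
Qed.

Variables (theta : R) (theta01 : 0 <= theta < 1).
Hypothesis beta_le : forall x a b, \sum_j beta x a b j <= theta.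
Local Notation val r k := (value i beta alpha r (pi k) sg).

Lemma measurable_discounted (r : K -> S -> A -> B -> R) :
  (forall k s a b, 0 <= r k s a b) ->
  measurable_fun [set: Om] (fun w : Om => discounted alpha r w).
Proof.
move=> r0; under eq_fun do rewrite discounted_series//.
apply: ge0_emeasurable_sum => n *; last exact: measurable_stage_reward.
by rewrite lee_fin stage_reward_ge0.
Qed.

Lemma expected_discounted_ge0 (r : K -> S -> A -> B -> R) z : 0 <= z ->
  (forall k s a b, 0 <= r k s a b <= z) ->
  (\int[P]_w discounted alpha r w = (\sum_k p k * val (r k) k)%:E)%E.
Proof.
move=> z0 rz; have r0 k s a b : 0 <= r k s a b by have /andP[] := rz k s a b.
under eq_integral do rewrite discounted_series//.
rewrite integral_nneseries//; last 2 first.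
- by move=> n; exact: measurable_stage_reward.
- by move=> n w _; rewrite lee_fin stage_reward_ge0.
apply/cvg_lim => //.
rewrite (_ : (fun n => _) = EFin \o (fun n => \sum_k p k *
    series (stage_payoff i beta alpha (r k) (pi k) sg) n)).
  apply: cvg_EFin; first by near=> n.
  rewrite (_ : fine \o _ = fun n => \sum_k p k *
    series (stage_payoff i beta alpha (r k) (pi k) sg) n)//.
  apply: cvg_big => [|k _]; first exact: add_continuous.
  apply: cvgM; first exact: cvg_cst.
  have laplace0 := laplace_ge0 hQ alpha_gt0.
  exact: (cvg_value laplace0 beta_le theta01 alpha_gt0 z0).
apply/funext => n /=; under eq_bigr do rewrite expected_stage_reward//.
rewrite sumEFin exchange_big /=; congr EFin; apply: eq_bigr => k _.
by rewrite /series /= mulr_sumr.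
Unshelve. all: by end_near. Qed.

(** Both parts of [r] are rates in [0,z], hence have finite discounted expectations, which may be
    subtracted. *)
Lemma expected_discounted (r : K -> S -> A -> B -> R) z :
  (forall k s a b, `|r k s a b| <= z) ->
  (\int[P]_w discounted alpha r w = (\sum_k p k * val (r k) k)%:E)%E.
Proof.
move=> rz.
have z0 : 0 <= z by apply: le_trans (rz point point point point).
pose rp k s a b := Num.max (r k s a b) 0.
pose rn k s a b := Num.max (- r k s a b) 0.
have rpz k s a b : 0 <= rp k s a b <= z.
  by rewrite le_max lexx orbT ge_max z0 andbT (le_trans (ler_norm _)).
have rnz k s a b : 0 <= rn k s a b <= z.
  by rewrite le_max lexx orbT ge_max z0 andbT (le_trans (ler_norm _))// normrN.
have rp0 k s a b : 0 <= rp k s a b by have /andP[] := rpz k s a b.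
have rn0 k s a b : 0 <= rn k s a b by have /andP[] := rnz k s a b.
have D0 q (w : Om) : (forall k s a b, 0 <= q k s a b) ->
    (0 <= discounted alpha q w)%E.
  by move=> q0; apply: integral_ge0 => t _; rewrite lee_fin mulr_ge0 ?expR_ge0.
have integrableD q : (forall k s a b, 0 <= q k s a b <= z) ->
    P.-integrable [set: Om] (fun w => discounted alpha q w).
  move=> qz; have q0 k s a b : 0 <= q k s a b by have /andP[] := qz k s a b.
  apply/integrableP; split; first exact: measurable_discounted.
  under eq_integral do rewrite gee0_abs ?D0//.
  by rewrite (expected_discounted_ge0 z0 qz) ltry.
under eq_integral do rewrite discounted_posneg.
rewrite integralB//; last 2 first.
- exact: (integrableD rp).
- exact: (integrableD rn).
rewrite (expected_discounted_ge0 z0 rpz) (expected_discounted_ge0 z0 rnz).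
rewrite -EFinB; congr EFin; rewrite -sumrB; apply: eq_bigr => k _.
rewrite -mulrBr; congr (_ * _).
have laplace0 := laplace_ge0 hQ alpha_gt0.
rewrite -(valueB i laplace0 beta_le theta01 alpha_gt0 _ _ z0 z0 (rpz k) (rnz k)).
congr (value _ _ _ _ _ _); apply/funext => s; apply/funext => a; apply/funext => b.
rewrite /rp /rn; case: (lerP (r k s a b) 0) => r0.
  by rewrite max_l ?oppr_ge0// opprK add0r.
by rewrite max_r ?oppr_le0 ?(ltW r0)// subr0.
Qed.

End law.

(** * Values of the game and of its dual *)

Section values.
Variables (R : realType) (K S A B : finPointedType).
Variables (Q : R -> S -> S -> A -> B -> R) (hQ : semi_markov_kernel Q).
Variables (c : K -> S -> A -> B -> R) (hc : forall k s a b, 0 <= c k s a b).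
Variables (alpha : R) (alpha_gt0 : 0 < alpha) (P : laws R K S A B).
Hypothesis hP : forall p i pi sg, game_law Q p i pi sg (P p i pi sg).
Variables (theta : R) (theta01 : 0 <= theta < 1).
Hypothesis beta_le : forall x a b, \sum_j laplace Q alpha x a b j <= theta.
Variable i : S.
Local Notation beta := (laplace Q alpha).
Local Notation pol1 := (forall n, history S A B n -> dist R A).

(** The abstract payoff [v] of the duality argument: a [policy1] is by definition a family of [pol1]
    indexed by the type. *)
Definition type_value (k : K) (t : pol1) (s : policy2 R S A B) : R :=
  value i beta alpha (c k) t s.

Lemma laplace_nonneg x a b j : 0 <= beta x a b j.
Proof. exact: (laplace_ge0 hQ alpha_gt0). Qed.

Lemma rate_le k s a b : c k s a b <= max_rate c.
Proof.
exact: (le_bigmax_cond 0 (fun x : K * S * A * B => c x.1.1.1 x.1.1.2 x.1.2 x.2)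
  (j := (k, s, a, b))).
Qed.

Lemma rate_bounded k s a b : 0 <= c k s a b <= max_rate c.
Proof. by rewrite hc rate_le. Qed.

Lemma max_rate_ge0 : 0 <= max_rate c.
Proof. exact: le_trans (hc point point point point) (rate_le _ _ _ _). Qed.

Lemma type_value_bounded k t s : 0 <= type_value k t s <= max_rate c / alpha.
Proof.
exact: (value_bounded i laplace_nonneg beta_le theta01 alpha_gt0 t s
  max_rate_ge0 (rate_bounded k)).
Qed.

Lemma type_value_mix1 l t1 t2 : 0 <= l <= 1 -> exists t, forall k s,
  type_value k t s = l * type_value k t1 s + (1 - l) * type_value k t2 s.
Proof.
move=> l01; have [t tP] := value_mix1 i laplace_nonneg beta_le theta01 alpha_gt0 t1 t2 l01.
by exists t => k s; exact: (tP _ _ s max_rate_ge0 (rate_bounded k)).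
Qed.

Lemma type_value_mix2 l s1 s2 : 0 <= l <= 1 -> exists s, forall k t,
  type_value k t s = l * type_value k t s1 + (1 - l) * type_value k t s2.
Proof.
move=> l01; have [s sP] := value_mix2 i laplace_nonneg beta_le theta01 alpha_gt0 s1 s2 l01.
by exists s => k t; exact: (sP _ _ t max_rate_ge0 (rate_bounded k)).
Qed.

Lemma payoffE p pi sg : payoff P alpha c p i pi sg = (pay type_value p pi sg)%:E.
Proof.
apply: (expected_discounted hQ alpha_gt0 (hP p i pi sg) theta01 beta_le (z := max_rate c)).
by move=> k s a b; rewrite ger0_norm ?hc// rate_le.
Qed.

Lemma dual_payoffE z hpi sg : dual_payoff P alpha c z i hpi sg =
  (pay type_value (hpi.1 i) hpi.2 sg - dot (hpi.1 i) (fun k => z k / alpha))%:E.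
Proof.
(* One bound for the signed rates c - z(k) of all types: c^* plus the sum of the |z(k)|. *)
rewrite /dual_payoff (expected_discounted hQ alpha_gt0 (hP (hpi.1 i) i hpi.2 sg)
  theta01 beta_le (z := max_rate c + \sum_k `|z k|)).
  congr EFin; rewrite /pay /dot -sumrB; apply: eq_bigr => k _.
  rewrite -mulrBr; congr (_ * _).
  exact: (valueB_cst i laplace_nonneg beta_le theta01 alpha_gt0 _ _ _
    max_rate_ge0 (rate_bounded k)).
move=> k s a b; apply: le_trans (ler_normB _ _) _.
rewrite ger0_norm ?hc// lerD// ?rate_le// (bigD1 k)//= lerDl.
by apply: sumr_ge0.
Qed.

Let pol1_0 : pol1 := fun _ _ => delta_dist R (point : A).
Let pol2_0 : policy2 R S A B := fun _ _ => delta_dist R (point : B).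

Lemma lower_valueE p : lower_value P alpha c p i = (low type_value p)%:E.
Proof.
rewrite /lower_value.
rewrite (_ : (fun pi => _) = fun pi => (inf (range (pay type_value p pi)))%:E).
  apply: (sup_range_EFin (c := max_rate c / alpha * \sum_k `|p k|) (fun=> pol1_0)) => pi.
  apply: (le_trans (inf_pay_le type_value_bounded p pi pol2_0)).
  exact: (pay_le type_value_bounded).
apply/funext => pi.
rewrite (_ : payoff _ _ _ _ _ _ = fun sg => (pay type_value p pi sg)%:E).
  by apply: (inf_range_EFin pol2_0) => sg; exact: (pay_ge type_value_bounded).
by apply/funext => sg; exact: payoffE.
Qed.

Lemma upper_valueE p : upper_value P alpha c p i = (upp type_value p)%:E.
Proof.
rewrite /upper_value.
rewrite (_ : (fun sg => _) = fun sg => (dot p (best type_value sg))%:E).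
  apply: (inf_range_EFin (c := - (max_rate c / alpha * \sum_k `|p k|)) pol2_0) => sg.
  have := weighted_bounded p (best_bounded pol1_0 type_value_bounded sg).
  by rewrite ler_norml => /andP[].
apply/funext => sg.
rewrite -(sup_pay pol1_0 type_value_bounded)//; last exact: simplex_dist.
rewrite (_ : (fun pi => _) = fun pi => (pay type_value p pi sg)%:E).
  by apply: (sup_range_EFin (fun=> pol1_0)) => pi; exact: (pay_le type_value_bounded).
by apply/funext => pi; exact: payoffE.
Qed.

Lemma dual_lower_valueE z : dual_lower_value P alpha c z i =
  (dual_low type_value (fun k => z k / alpha))%:E.
Proof.
set y := fun k => z k / alpha.
pose g (x : dist R K * (K -> pol1)) : R :=
  inf (range (fun s => pay type_value x.1 x.2 s - dot x.1 y)).
rewrite /dual_lower_value.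
transitivity (ereal_sup (range (fun x => (g x)%:E))).
  have gE (hpi : dual_policy1 R K S A B) :
      ereal_inf (range (dual_payoff P alpha c z i hpi)) = (g (hpi.1 i, hpi.2))%:E.
    rewrite (_ : dual_payoff _ _ _ _ _ _ = fun sg => (pay type_value (hpi.1 i) hpi.2 sg
      - dot (hpi.1 i) y)%:E); last by apply/funext => sg; exact: dual_payoffE.
    apply: (inf_range_EFin (c := - (max_rate c / alpha) - \sum_k `|y k|) pol2_0) => sg.
    rewrite lerB ?dot_le// (le_trans _ (pay_ge type_value_bounded _ _ _))//.
    by rewrite sum_norm_dist mulr1.
  (* Only rho_i matters when the initial state is i; conversely, any prior comes from a constant
     family rho. *)
  congr ereal_sup; apply/seteqP; split=> _ [x _ <-].
    by exists (x.1 i, x.2) => //; rewrite gE.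
  by exists (fun=> x.1, x.2) => //; rewrite gE; case: x.
apply: (sup_range_EFin (c := max_rate c / alpha + \sum_k `|y k|)
  (delta_dist R (point : K), fun=> pol1_0)) => -[q pi].
rewrite /g (inf_dual (M := max_rate c / alpha) pol2_0 type_value_bounded) /=.
have := le_trans (inf_pay_le type_value_bounded q pi pol2_0)
  (pay_le type_value_bounded _ _ _).
by rewrite sum_norm_dist mulr1; have := dot_ge q y; lra.
Qed.

Lemma dual_upper_valueE z : dual_upper_value P alpha c z i =
  (dual_upp type_value (fun k => z k / alpha))%:E.
Proof.
set y := fun k => z k / alpha.
pose g s (x : dist R K * (K -> pol1)) : R := pay type_value x.1 x.2 s - dot x.1 y.
have g_le s x : g s x <= max_rate c / alpha + \sum_k `|y k|.
  have := pay_le type_value_bounded x.1 x.2 s; have := dot_ge x.1 y.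
  by rewrite sum_norm_dist mulr1 /g; lra.
have g_ge s x : - (max_rate c / alpha) - \sum_k `|y k| <= g s x.
  have := pay_ge type_value_bounded x.1 x.2 s; have := dot_le x.1 y.
  by rewrite sum_norm_dist mulr1 /g; lra.
pose x0 := (delta_dist R (point : K), fun=> pol1_0) : dist R K * (K -> pol1).
rewrite /dual_upper_value (_ : (fun sg => _) = fun sg => (sup (range (g sg)))%:E).
  apply: (inf_range_EFin pol2_0) => sg.
  by apply: le_trans (g_ge sg x0) _; exact: le_sup_range (g_le sg).
apply/funext => sg; rewrite -(sup_range_EFin x0 (g_le sg)); congr ereal_sup.
apply/seteqP; split=> _ [x _ <-].
  by exists (x.1 i, x.2) => //; rewrite dual_payoffE.
by exists (fun=> x.1, x.2) => //; rewrite dual_payoffE.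
Qed.

Lemma pairingE (p : dist R K) z : alpha^-1 * pairing p z = dot p (fun k => z k / alpha).
Proof. by rewrite /pairing mulr_sumr; apply: eq_bigr => k _; ring. Qed.

Lemma dual_values_maximum z :
  is_max (range (fun p : dist R K =>
      lower_value P alpha c p i - (alpha^-1 * pairing p z)%:E)%E)
    (dual_lower_value P alpha c z i) /\
  is_max (range (fun p : dist R K =>
      upper_value P alpha c p i - (alpha^-1 * pairing p z)%:E)%E)
    (dual_upper_value P alpha c z i).
Proof.
rewrite dual_lower_valueE dual_upper_valueE; split; split.
- have [p ->] := dual_low_maximum (point : K) pol1_0 pol2_0 type_value_bounded
    type_value_mix1 (fun k => z k / alpha).
  by exists p => //; rewrite lower_valueE pairingE.
- move=> _ [p _ <-]; rewrite lower_valueE pairingE lee_fin.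
  by apply: (le_dual_low pol1_0 pol2_0 type_value_bounded); exact: simplex_dist.
- have [p ->] := dual_upp_maximum (point : K) pol1_0 pol2_0 type_value_bounded
    type_value_mix2 (fun k => z k / alpha).
  by exists p => //; rewrite upper_valueE pairingE.
- move=> _ [p _ <-]; rewrite upper_valueE pairingE lee_fin.
  by apply: (le_dual_upp pol1_0 pol2_0 type_value_bounded); exact: simplex_dist.
Qed.

(** Converts a minimiser y of the abstract game into z = alpha y, undoing y = z/alpha. *)
Lemma rate_box_scale (y : K -> R) :
  (forall k, 0 <= y k <= max_rate c / alpha) -> rate_box c (fun k => alpha * y k).
Proof.
move=> yM k; have /andP[y0 yM'] := yM k.
by rewrite mulr_ge0 ?(ltW alpha_gt0)//= mulrC -ler_pdivlMr.
Qed.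

Lemma values_minimum (p : dist R K) :
  is_min [set (dual_lower_value P alpha c z i
                + (alpha^-1 * pairing p z)%:E)%E | z in rate_box c]
    (lower_value P alpha c p i) /\
  is_min [set (dual_upper_value P alpha c z i
                + (alpha^-1 * pairing p z)%:E)%E | z in rate_box c]
    (upper_value P alpha c p i).
Proof.
have scaleK (y : K -> R) : (fun k => alpha * y k / alpha) = y.
  by apply/funext => k; rewrite mulrC mulKf// gt_eqF.
have [low_le [y yM yE]] := low_minimum (point : K) pol1_0 pol2_0 type_value_bounded
  type_value_mix1 (simplex_dist p).
have [upp_le [y' y'M y'E]] := upp_minimum (point : K) pol1_0 pol2_0 type_value_bounded
  type_value_mix2 (simplex_dist p).
rewrite lower_valueE upper_valueE; split; split.
- exists (fun k => alpha * y k); first exact: rate_box_scale.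
  by rewrite dual_lower_valueE pairingE scaleK yE.
- by move=> _ [z _ <-]; rewrite dual_lower_valueE pairingE lee_fin low_le.
- exists (fun k => alpha * y' k); first exact: rate_box_scale.
  by rewrite dual_upper_valueE pairingE scaleK y'E.
- by move=> _ [z _ <-]; rewrite dual_upper_valueE pairingE lee_fin upp_le.
Qed.

End values.

Theorem theorem5p5 (R : realType) (K S A B : finPointedType)
    (Q : R -> S -> S -> A -> B -> R) (hQ : semi_markov_kernel Q)
    (c : K -> S -> A -> B -> R) (hc : forall k s a b, 0 <= c k s a b)
    (alpha : R) (halpha : 0 < alpha)
    (P : laws R K S A B)
    (hP : forall p i pi sg, game_law Q p i pi sg (P p i pi sg))
    (hD : exists delta eps : R, 0 < delta /\ 0 < eps < 1 /\
      forall i a b, sojourn_cdf Q delta i a b <= 1 - eps) :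
  (forall (i : S) (z : K -> R),
    is_max (range (fun p : dist R K =>
        lower_value P alpha c p i - (alpha^-1 * pairing p z)%:E)%E)
      (dual_lower_value P alpha c z i) /\
    is_max (range (fun p : dist R K =>
        upper_value P alpha c p i - (alpha^-1 * pairing p z)%:E)%E)
      (dual_upper_value P alpha c z i)) /\
  (forall (i : S) (p : dist R K),
    is_min [set (dual_lower_value P alpha c z i
                  + (alpha^-1 * pairing p z)%:E)%E | z in rate_box c]
      (lower_value P alpha c p i) /\
    is_min [set (dual_upper_value P alpha c z i
                  + (alpha^-1 * pairing p z)%:E)%E | z in rate_box c]
      (upper_value P alpha c p i)).
Proof.
have [delta [eps [delta0 [eps01 cdf_le]]]] := hD.
have beta_le := laplace_sum_le hQ halpha delta0 eps01 cdf_le.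
(* The constant equals 1 - eps (1 - e^{-alpha delta}), which is below 1 since eps and alpha delta
   are positive. *)
have theta01 : 0 <= 1 - eps + eps * discount alpha delta < 1.
  have /andP[e0 e1] := eps01.
  have d1 : discount alpha delta < 1.
    by rewrite -expR0 ltr_expR oppr_lt0 mulr_gt0.
  have d0 := discount_ge0 alpha delta.
  by apply/andP; split; nra.
by split=> [i z|i p];
  [exact: (dual_values_maximum hQ hc halpha hP theta01 beta_le)
  |exact: (values_minimum hQ hc halpha hP theta01 beta_le)].
Qed.
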